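(* Assume that $k,\rho,c$ and $\mu$ (with $v(T)=\mu(T)/\sqrt t$) satisfy the boundedness and Lipschitz hypotheses (K), (R), (V) listed in the context, and that $$\frac{\big(2\mathrm{Bi}+r({T^*}^4-T_m^4)\big)\sqrt{k_0\rho_0c_0k_M}}{k_m\sqrt{\gamma_m}}\sqrt\pi\,\exp\Big(\frac{\nu_M^2k_M}{k_m^2\gamma_m}\Big)<1,\qquad \frac{(2\mathrm{Bi}+rD_5)\sqrt{\rho_0c_0k_0}}{\nu_M}<1 .$$ Let $\lambda_{2r}>0$ be a solution of $\mathcal V_2^r(\lambda)=\lambda$, and assume $\mathcal E_r(\lambda_{2r})<1$. Then there exists at least one solution $(T,s)$ of the Stefan problem $$\rho(T)c(T)\frac{\partial T}{\partial t}=\frac{\partial}{\partial x}\Big(k(T)\frac{\partial T}{\partial x}\Big)-v(T)\frac{\partial T}{\partial x},\quad 0<x<s(t),\ t>0,$$ $$k(T(0,t))\frac{\partial T}{\partial x}(0,t)=\frac{h}{\sqrt t}\big[T(0,t)-T^*\big]+\frac{\sigma\epsilon}{\sqrt t}\big[T^4(0,t)-{T^*}^4\big],\quad t>0,$$ $$T(s(t),t)=T_m,\qquad k(T(s(t),t))\frac{\partial T}{\partial x}(s(t),t)=-\rho_0\ell\,\dot s(t),\quad t>0,\qquad s(0)=0,$$ where the free boundary is $s(t)=2\widetilde\lambda_r\sqrt{\alpha_0t}$, $t>0$, with $\widetilde\lambda_r\in(0,\lambda_{2r})$ a solution of $\mathcal V^r(\lambda)=\lambda$, and the temperature is $$T(x,t)=(T_m-T^*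 )f_{\widetilde\lambda_r}(\xi)+T^*,\qquad \xi=\frac{x}{2\sqrt{\alpha_0t}},\quad 0\le\xi\le\widetilde\lambda_r,$$ where $f_{\widetilde\lambda_r}$ is the unique solution, in $X=\{f\in C^0[0,\widetilde\lambda_r]: f\ge0,\ \|f\|\le1\}$, of $f(\xi)=1-G(f)(0)\big(\Phi(f)(\widetilde\lambda_r)-\Phi(f)(\xi)\big)$, $0\le\xi\le\widetilde\lambda_r$.
   Context: Data: constants $T^*>T_m>0$; positive constants $h,\sigma,\epsilon,\rho_0,c_0,k_0,\ell$; $\alpha_0=k_0/(\rho_0c_0)$; $\mathrm{Ste}=(T^*-T_m)c_0/\ell$; $\mathrm{Bi}=h\sqrt{\alpha_0}/k_0$; $r=\frac{2\sigma\epsilon\sqrt{\alpha_0}}{k_0(T^*-T_m)}$; $D_5=4(T^*-T_m)|T^*|^3$. The coefficients $k,\rho,c,\mu$ are real functions of temperature acting by composition, e.g. $k(T)(x,t)=k(T(x,t))$, and the convective speed is $v(T)=\mu(T)/\sqrt t$. Let $\mathscr C=C^0(\mathbb R_0^+\times\mathbb R^+)\cap L^\infty(\mathbb R_0^+\times\mathbb R^+)$ with the supremum norm $\|\cdot\|$ (the same notation is used for the supremum norm on $C^0[0,\lambda]$). Hypotheses: there are positive constants $k_m,k_M,\widetilde k,\gamma_m,\gamma_M,\widetilde\gamma,\nu_m,\nu_M,\widetilde\nu$ such that for all $T,T_1,T_2\in\mathscr C$: (K) $k_m\le k(T)\le k_M$ and $\|k(T_1)-k(T_2)\|\le\widetilde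 k\|T_1-T_2\|$; (R) $\gamma_m\le\rho(T)c(T)\le\gamma_M$ and $\|\rho(T_1)c(T_1)-\rho(T_2)c(T_2)\|\le\widetilde\gamma\|T_1-T_2\|$; (V) $\nu_m\le\mu(T)\le\nu_M$ and $\|\mu(T_1)-\mu(T_2)\|\le\widetilde\nu\|T_1-T_2\|$. For a function $f$ of $\xi$ put $T=(T_m-T^* )f+T^*$ and $L^*(f)=k(T)/k_0$, $N^*(f)=\rho(T)c(T)/(\rho_0c_0)$, $\mu^*(f)=\mu(T)/\sqrt{\rho_0c_0k_0}$ (pointwise in $\xi$). Constants: $L_m=k_m/k_0$, $L_M=k_M/k_0$, $\widetilde L=\widetilde k(T^*-T_m)/k_0$, $N_m=\gamma_m/(\rho_0c_0)$, $N_M=\gamma_M/(\rho_0c_0)$, $\widetilde N=\widetilde\gamma(T^*-T_m)/(\rho_0c_0)$, $\mu_m=\nu_m/\sqrt{\rho_0c_0k_0}$, $\mu_M=\nu_M/\sqrt{\rho_0c_0k_0}$, $\widetilde\mu=\widetilde\nu(T^*-T_m)/\sqrt{\rho_0c_0k_0}$. For $f\in C^0[0,\lambda]$: $U(f)(z)=\exp\big(2\int_0^z\frac{\mu^*(f)(\sigma)}{L^*(f)(\sigma)}d\sigma\big)$, $I(f)(z)=\exp\big(2\int_0^z\frac{\sigma N^*(f)(\sigma)}{L^*(f)(\sigma)}d\sigma\big)$ (here $\sigma$ is an integration variable), $E(f)=U(f)/I(f)$, $\Phi(f)(\xi)=\int_0^\xi\frac{E(f)(z)}{L^*(f)(z)}dz$,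 $F(f)(0)={T^*}^4-\big((T_m-T^* )f(0)+T^*\big)^4$, $G(f)(0)=2\mathrm{Bi}\,f(0)+rF(f)(0)$. Define, for $z\ge0$, $D_1(z)=\frac{2\exp(2\mu_Mz/L_m)}{L_m^2}z(\mu_M\widetilde L+L_m\widetilde\mu)$, $D_2(z)=\frac{\exp(N_Mz^2/L_m)}{L_m^2}z^2(N_M\widetilde L+L_m\widetilde N)$, $D_3(z)=\exp(\frac{N_M}{L_m}z^2)D_1(z)+\exp(2\frac{\mu_M}{L_m}z)D_2(z)$, $D_4(z)=\frac1{L_m^2}\big(\widetilde L\exp(2z\frac{\mu_M}{L_m})+L_mD_3(z)\big)$, and $\mathcal E_r(z)=2(2\mathrm{Bi}+r{T^*}^4)zD_4(z)+\exp(2\frac{\mu_M}{L_m}z)\frac{2\mathrm{Bi}+rD_5}{\mu_M}$. Let $\overline\lambda_r>0$ be the unique solution of $\mathcal E_r(z)=1$. For $0<\lambda<\overline\lambda_r$, $f_\lambda$ denotes the unique element of $\{f\in C^0[0,\lambda]:f\ge0,\|f\|\le1\}$ with $f_\lambda(\xi)=1-G(f_\lambda)(0)(\Phi(f_\lambda)(\lambda)-\Phi(f_\lambda)(\xi))$ on $[0,\lambda]$, and $\mathcal V^r(\lambda)=\frac{\mathrm{Ste}\,G(f_\lambda)(0)}2E(f_\lambda)(\lambda)$. For $\lambda>0$: $\mathcal V_2^r(\lambda)=\frac{\mathrm{Ste}(2\mathrm{Bi}+r{T^*}^4)}2\exp(2\lambda\frac{\mu_M}{L_m}-\lambda^2\frac{N_m}{L_M})$;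 the equation $\mathcal V_2^r(\lambda)=\lambda$ has at least one positive solution. *)

(* Defs.v *)
From Stdlib Require Import Reals.
From Coquelicot Require Import Coquelicot.
Local Open Scope R_scope.

(* Physical constants, temperature-dependent coefficients, and the constants of
   the boundedness/Lipschitz hypotheses on these coefficients. *)
Class stefan_data : Type := Build_stefan_data {
  Tstar : R; Tm : R;
  h : R; sigma : R; eps : R; rho0 : R; c0 : R; k0 : R; ell : R;
  coef_k : R -> R; coef_rho : R -> R; coef_c : R -> R; coef_mu : R -> R;
  k_m : R; k_M : R; k_tilde : R;
  gamma_m : R; gamma_M : R; gamma_tilde : R;
  nu_m : R; nu_M : R; nu_tilde : R
}.

Record positive_data {d : stefan_data} : Prop := {
  Tm_pos : 0 < Tm; Tm_lt_Tstar : Tm < Tstar;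
  h_pos : 0 < h; sigma_pos : 0 < sigma; eps_pos : 0 < eps;
  rho0_pos : 0 < rho0; c0_pos : 0 < c0; k0_pos : 0 < k0; ell_pos : 0 < ell;
  k_m_pos : 0 < k_m; k_M_pos : 0 < k_M; k_tilde_pos : 0 < k_tilde;
  gamma_m_pos : 0 < gamma_m; gamma_M_pos : 0 < gamma_M;
  gamma_tilde_pos : 0 < gamma_tilde;
  nu_m_pos : 0 < nu_m; nu_M_pos : 0 < nu_M; nu_tilde_pos : 0 < nu_tilde
}.

Definition alpha0 {d : stefan_data} : R := k0 / (rho0 * c0).
Definition Ste {d : stefan_data} : R := (Tstar - Tm) * c0 / ell.
Definition Bi {d : stefan_data} : R := h * sqrt alpha0 / k0.
Definition rad {d : stefan_data} : R :=
  2 * sigma * eps * sqrt alpha0 / (k0 * (Tstar - Tm)).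
Definition D5 {d : stefan_data} : R := 4 * (Tstar - Tm) * Rabs Tstar ^ 3.

(* Extended-real valued, so that [supnorm D g <= M] is never true by default
   when [g] is unbounded on [D]. *)
Definition supnorm {A : Type} (D : A -> Prop) (g : A -> R) : Rbar :=
  Lub_Rbar (fun y => exists a, D a /\ y = Rabs (g a)).

Definition quadrant (p : R * R) : Prop := 0 <= fst p /\ 0 < snd p.

Definition in_C (T : R * R -> R) : Prop :=
  continuous_on quadrant T /\ is_finite (supnorm quadrant T).

Definition bounded_lipschitz (g : R -> R) (m M l : R) : Prop :=
  (forall T, in_C T -> forall p, quadrant p -> m <= g (T p) <= M) /\
  (forall T1 T2, in_C T1 -> in_C T2 ->
     Rbar_le (supnorm quadrant (fun p => g (T1 p) - g (T2 p)))
             (Rbar_mult l (supnorm quadrant (fun p => T1 p - T2 p)))).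

Definition hyp_K {d : stefan_data} : Prop :=
  bounded_lipschitz coef_k k_m k_M k_tilde.
Definition hyp_R {d : stefan_data} : Prop :=
  bounded_lipschitz (fun y => coef_rho y * coef_c y) gamma_m gamma_M gamma_tilde.
Definition hyp_V {d : stefan_data} : Prop :=
  bounded_lipschitz coef_mu nu_m nu_M nu_tilde.

Definition temp {d : stefan_data} (y : R) : R := (Tm - Tstar) * y + Tstar.
Definition Lstar {d : stefan_data} (f : R -> R) (xi : R) : R :=
  coef_k (temp (f xi)) / k0.
Definition Nstar {d : stefan_data} (f : R -> R) (xi : R) : R :=
  coef_rho (temp (f xi)) * coef_c (temp (f xi)) / (rho0 * c0).
Definition mustar {d : stefan_data} (f : R -> R) (xi : R) : R :=
  coef_mu (temp (f xi)) / sqrt (rho0 * c0 * k0).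

Definition L_m {d : stefan_data} : R := k_m / k0.
Definition L_M {d : stefan_data} : R := k_M / k0.
Definition L_tilde {d : stefan_data} : R := k_tilde * (Tstar - Tm) / k0.
Definition N_m {d : stefan_data} : R := gamma_m / (rho0 * c0).
Definition N_M {d : stefan_data} : R := gamma_M / (rho0 * c0).
Definition N_tilde {d : stefan_data} : R :=
  gamma_tilde * (Tstar - Tm) / (rho0 * c0).
Definition mu_m {d : stefan_data} : R := nu_m / sqrt (rho0 * c0 * k0).
Definition mu_M {d : stefan_data} : R := nu_M / sqrt (rho0 * c0 * k0).
Definition mu_tilde {d : stefan_data} : R :=
  nu_tilde * (Tstar - Tm) / sqrt (rho0 * c0 * k0).

Definition opU {d : stefan_data} (f : R -> R) (z : R) : R :=
  exp (2 * RInt (fun y => mustar f y / Lstar f y) 0 z).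
Definition opI {d : stefan_data} (f : R -> R) (z : R) : R :=
  exp (2 * RInt (fun y => y * Nstar f y / Lstar f y) 0 z).
Definition opE {d : stefan_data} (f : R -> R) (z : R) : R := opU f z / opI f z.
Definition opPhi {d : stefan_data} (f : R -> R) (xi : R) : R :=
  RInt (fun z => opE f z / Lstar f z) 0 xi.
Definition F0 {d : stefan_data} (f : R -> R) : R :=
  Tstar ^ 4 - ((Tm - Tstar) * f 0 + Tstar) ^ 4.
Definition G0 {d : stefan_data} (f : R -> R) : R :=
  2 * Bi * f 0 + rad * F0 f.

Definition D1 {d : stefan_data} (z : R) : R :=
  2 * exp (2 * mu_M * z / L_m) / L_m ^ 2 * z * (mu_M * L_tilde + L_m * mu_tilde).
Definition D2 {d : stefan_data} (z : R) : R :=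
  exp (N_M * z ^ 2 / L_m) / L_m ^ 2 * z ^ 2 * (N_M * L_tilde + L_m * N_tilde).
Definition D3 {d : stefan_data} (z : R) : R :=
  exp (N_M / L_m * z ^ 2) * D1 z + exp (2 * (mu_M / L_m) * z) * D2 z.
Definition D4 {d : stefan_data} (z : R) : R :=
  1 / L_m ^ 2 * (L_tilde * exp (2 * z * (mu_M / L_m)) + L_m * D3 z).
Definition calE {d : stefan_data} (z : R) : R :=
  2 * (2 * Bi + rad * Tstar ^ 4) * z * D4 z
  + exp (2 * (mu_M / L_m) * z) * ((2 * Bi + rad * D5) / mu_M).

Definition is_lambda_bar {d : stefan_data} (lbar : R) : Prop :=
  unique (fun z => 0 < z /\ calE z = 1) lbar.

(* Elements of C^0[0,lam] are represented by functions on R of which only the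
   values on [0,lam] matter; equality is equality on [0,lam]. *)
Definition segment (lam xi : R) : Prop := 0 <= xi <= lam.

Definition in_X (lam : R) (f : R -> R) : Prop :=
  continuous_on (segment lam) f /\
  (forall xi, segment lam xi -> 0 <= f xi) /\
  Rbar_le (supnorm (segment lam) f) 1.

Definition fixed_point {d : stefan_data} (lam : R) (f : R -> R) : Prop :=
  forall xi, segment lam xi -> f xi = 1 - G0 f * (opPhi f lam - opPhi f xi).

Definition is_f_lambda {d : stefan_data} (lam : R) (f : R -> R) : Prop :=
  in_X lam f /\ fixed_point lam f /\
  forall g, in_X lam g -> fixed_point lam g ->
    forall xi, segment lam xi -> g xi = f xi.

(* The graph of V^r, whose domain is ]0, lambda_bar[. *)
Definition is_calV {d : stefan_data} (lam v : R) : Prop :=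
  (exists lbar, is_lambda_bar lbar /\ 0 < lam < lbar) /\
  exists f, is_f_lambda lam f /\ v = Ste * G0 f / 2 * opE f lam.

Definition calV2 {d : stefan_data} (lam : R) : R :=
  Ste * (2 * Bi + rad * Tstar ^ 4) / 2
  * exp (2 * lam * (mu_M / L_m) - lam ^ 2 * (N_m / L_M)).

(* Derivative relative to [D]: one-sided at an endpoint of an interval. *)
Definition is_derive_within (D : R -> Prop) (g : R -> R) (x l : R) : Prop :=
  filterlim (fun y => (g y - g x) / (y - x)) (within D (locally' x)) (locally l).

(* [Tx], [Tt], [qx], [ds] are the derivatives of T in x, of T in t, of the flux
   k(T) Tx in x, and of s. The coefficient k is only Lipschitz, so the flux is
   differentiated as a whole. Values of T outside 0 <= x <= s t, 0 < t are irrelevant. *)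
Definition stefan_solution {d : stefan_data} (T : R -> R -> R) (s : R -> R)
    : Prop :=
  s 0 = 0 /\
  continuous_on (fun t => 0 <= t) s /\
  (forall t, 0 < t -> 0 < s t) /\
  continuous_on (fun p : R * R => 0 < snd p /\ 0 <= fst p <= s (snd p))
    (fun p => T (fst p) (snd p)) /\
  exists (Tx Tt qx : R -> R -> R) (ds : R -> R),
    (forall t, 0 < t -> is_derive s t (ds t)) /\
    (forall x t, 0 < t -> 0 <= x <= s t ->
       is_derive_within (segment (s t)) (fun y => T y t) x (Tx x t)) /\
    (forall x t, 0 < t -> 0 < x < s t ->
       is_derive (fun tau => T x tau) t (Tt x t) /\
       is_derive (fun y => coef_k (T y t) * Tx y t) x (qx x t) /\
       coef_rho (T x t) * coef_c (T x t) * Tt x t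
       = qx x t - coef_mu (T x t) / sqrt t * Tx x t) /\
    (forall t, 0 < t ->
       coef_k (T 0 t) * Tx 0 t
       = h / sqrt t * (T 0 t - Tstar)
         + sigma * eps / sqrt t * (T 0 t ^ 4 - Tstar ^ 4)) /\
    (forall t, 0 < t -> T (s t) t = Tm) /\
    (forall t, 0 < t -> coef_k (T (s t) t) * Tx (s t) t = - rho0 * ell * ds t).

(* Main.v *)
(* With xi = x / (2 sqrt (alpha0 t)), a temperature (Tm - Tstar) f xi + Tstar solves
   the problem with front s t = 2 lam sqrt (alpha0 t) exactly when L f' = G E, that is
   when f is a fixed point of the integral operator on [0, lam], and when lam = V lam.
   The first smallness condition and the Gaussian integral make the operator preserve
   [0, 1]-valued functions; it contracts with factor at most calE lam <= calE lam2 < 1.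
   Extending functions by clamping their argument to [0, lam] places the operators of
   all lam in [0, lam2] on one space with one contraction factor, so that f_lambda, hence
   V, is continuous in lam, including lam = 0, where V 0 > 0. Since G < 2 Bi + r Tstar^4
   strictly, V lam2 < calV2 lam2 = lam2, and V has a fixed point strictly in between. *)
Require Import Defs.
From Stdlib Require Import Reals Lra Psatz.
From Coquelicot Require Import Coquelicot.
Local Open Scope R_scope.

Lemma exp_diff_le (a b M : R) :
  a <= M -> b <= M -> Rabs (exp a - exp b) <= exp M * Rabs (a - b).
Proof.
  assert (main : forall u v, v <= u -> u <= M -> exp u - exp v <= exp M * (u - v)).
  { intros u v vu uM.
    replace (exp v) with (exp u * exp (v - u)) by (rewrite <- exp_plus; f_equal; ring).
    pose proof (exp_ineq1_le (v - u)). pose proof (exp_pos u).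
    assert (exp u <= exp M) by (destruct uM as [? | ->]; [left; apply exp_increasing |]; lra).
    nra. }
  intros aM bM. destruct (Rle_dec b a) as [ba | ab].
  - rewrite !Rabs_pos_eq; [auto | lra |].
    destruct ba as [ba | ->]; [apply exp_increasing in ba |]; lra.
  - rewrite Rabs_minus_sym, (Rabs_minus_sym a), !Rabs_pos_eq; [apply main; lra | lra |].
    assert (E : a < b) by lra. apply exp_increasing in E; lra.
Qed.

Lemma exp_le (a b : R) : a <= b -> exp a <= exp b.
Proof. intros [ab | ->]; [left; apply exp_increasing |]; lra. Qed.

Lemma exp_ge_1 (a : R) : 0 <= a -> 1 <= exp a.
Proof. intros a0. rewrite <- exp_0. now apply exp_le. Qed.

Lemma pow4_diff_le (a b M : R) :
  0 <= a <= M -> 0 <= b <= M -> Rabs (a ^ 4 - b ^ 4) <= 4 * M ^ 3 * Rabs (a - b).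
Proof.
  intros Ha Hb.
  replace (a ^ 4 - b ^ 4) with (((a + b) * (a ^ 2 + b ^ 2)) * (a - b)) by ring.
  rewrite Rabs_mult. apply Rmult_le_compat_r; [apply Rabs_pos |].
  assert (0 <= a ^ 2 <= M ^ 2) by (split; nra).
  assert (0 <= b ^ 2 <= M ^ 2) by (split; nra).
  rewrite Rabs_pos_eq by nra.
  replace (4 * M ^ 3) with ((M + M) * (M ^ 2 + M ^ 2)) by ring.
  apply Rmult_le_compat; lra.
Qed.

Lemma quotient_bounds (a m M l lm lM : R) :
  0 <= m -> m <= a <= M -> 0 < lm -> lm <= l <= lM -> m / lM <= a / l <= M / lm.
Proof.
  intros m0 Ha lm0 Hl.
  assert (0 < / lM <= / l) by
    (split; [apply Rinv_0_lt_compat | apply Rinv_le_contravar]; lra).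
  assert (/ l <= / lm) by (apply Rinv_le_contravar; lra).
  split; apply Rmult_le_compat; lra.
Qed.

Lemma div_bounds (a m M c : R) : 0 < c -> m <= a <= M -> m / c <= a / c <= M / c.
Proof.
  intros c0 H. pose proof (Rinv_0_lt_compat c c0).
  split; apply Rmult_le_compat_r; lra.
Qed.

Lemma quotient_diff_le (m1 m2 l1 l2 M Lm dm dl : R) :
  0 < Lm -> 0 <= m2 <= M -> Lm <= l1 -> Lm <= l2 ->
  Rabs (m1 - m2) <= dm -> Rabs (l1 - l2) <= dl ->
  Rabs (m1 / l1 - m2 / l2) <= (M * dl + Lm * dm) / Lm ^ 2.
Proof.
  intros Lm0 Hm H1 H2 Hdm Hdl.
  replace (m1 / l1 - m2 / l2)
    with ((m1 - m2) * / l1 + (m2 * / l1 * / l2) * (l2 - l1)) by (field; lra).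
  replace ((M * dl + Lm * dm) / Lm ^ 2)
    with (dm * / Lm + (M * / Lm * / Lm) * dl) by (field; lra).
  assert (I1 : 0 < / l1 <= / Lm).
  { split; [apply Rinv_0_lt_compat | apply Rinv_le_contravar]; lra. }
  assert (I2 : 0 < / l2 <= / Lm).
  { split; [apply Rinv_0_lt_compat | apply Rinv_le_contravar]; lra. }
  eapply Rle_trans; [apply Rabs_triang |]. rewrite !(Rabs_mult _ (_ - _)).
  rewrite (Rabs_mult (m1 - m2)).
  rewrite (Rabs_pos_eq (/ l1)) by lra.
  assert (0 <= m2 * / l1) by (apply Rmult_le_pos; lra).
  rewrite (Rabs_pos_eq (m2 * / l1 * / l2)) by (apply Rmult_le_pos; lra).
  rewrite (Rabs_minus_sym l2).
  apply Rplus_le_compat; apply Rmult_le_compat;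
    try apply Rabs_pos; try apply Rmult_le_pos; try lra.
  apply Rmult_le_compat; try lra. apply Rmult_le_compat; lra.
Qed.

Lemma continuous_at_of_le (g : R -> R) (M b : R) :
  (forall a, Rabs (g a - g b) <= M * Rabs (a - b)) -> continuous g b.
Proof.
  intros H. apply continuity_pt_filterlim. intros e e0.
  exists (e / (Rabs M + 1)). pose proof (Rabs_pos M).
  split; [apply Rdiv_lt_0_compat; lra |].
  intros x [_ Hx]. unfold R_dist, dist in *; simpl in *. unfold R_dist in *.
  apply (Rmult_lt_compat_r (Rabs M + 1)) in Hx; [| lra].
  unfold Rdiv in Hx. rewrite Rmult_assoc, Rinv_l, Rmult_1_r in Hx by lra.
  eapply Rle_lt_trans; [apply H |]. pose proof (Rle_abs M). pose proof (Rabs_pos (x - b)).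
  nra.
Qed.

Lemma continuous_div (p q : R -> R) (x : R) :
  continuous p x -> continuous q x -> q x <> 0 -> continuous (fun y => p y / q y) x.
Proof.
  intros Hp Hq Hx. apply (continuous_mult p (fun y => / q y)); [trivial |].
  apply (continuous_comp q Rinv); [trivial |]. now apply continuous_Rinv.
Qed.

Lemma continuous_of_dominated (p f : R -> R) (l x : R) :
  (forall y, Rabs (p y - p x) <= l * Rabs (f y - f x)) -> continuous f x -> continuous p x.
Proof.
  intros H Hf. apply continuity_pt_filterlim. apply continuity_pt_filterlim in Hf.
  intros e e0. pose proof (Rabs_pos l).
  destruct (Hf (e / (Rabs l + 1))) as (a & a0 & Ha); [apply Rdiv_lt_0_compat; lra |].
  exists a. split; [trivial |]. intros y Hy. specialize (Ha y Hy).
  unfold dist in *; simpl in *; unfold R_dist in *.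
  apply (Rmult_lt_compat_r (Rabs l + 1)) in Ha; [| lra].
  unfold Rdiv in Ha. rewrite Rmult_assoc, Rinv_l, Rmult_1_r in Ha by lra.
  eapply Rle_lt_trans; [apply H |].
  pose proof (Rle_abs l). pose proof (Rabs_pos (f y - f x)). nra.
Qed.

Lemma is_derive_derive_within (D : R -> Prop) (g : R -> R) (x l : R) :
  is_derive g x l -> is_derive_within D g x l.
Proof.
  intros Hg%is_derive_Reals P [e HP].
  destruct (Hg e (cond_pos e)) as [a Ha]. exists a. intros y Hy yx _.
  apply HP. specialize (Ha (y - x) ltac:(lra) Hy).
  now rewrite (Rplus_minus x y) in Ha.
Qed.

Lemma ex_RInt_cont (p : R -> R) (a b : R) :
  (forall x, continuous p x) -> ex_RInt p a b.
Proof. intros Hp. apply (ex_RInt_continuous (V := R_CompleteNormedModule)). auto. Qed.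

Lemma is_derive_RInt_cont (p : R -> R) (a x : R) :
  (forall x, continuous p x) -> is_derive (RInt p a) x (p x).
Proof.
  intros Hp. apply (is_derive_RInt p (RInt p a) a x).
  - apply filter_forall. intros y. apply (RInt_correct p). now apply ex_RInt_cont.
  - apply Hp.
Qed.

Lemma RInt_minus_from (p : R -> R) (c a b : R) :
  (forall x, continuous p x) -> RInt p c b - RInt p c a = RInt p a b.
Proof.
  intros Hp.
  rewrite <- (RInt_Chasles p c a b) by now apply ex_RInt_cont.
  unfold plus; simpl; ring.
Qed.

Lemma RInt_diff_le (p q : R -> R) (a b M : R) :
  (forall x, continuous p x) -> (forall x, continuous q x) -> a <= b ->
  (forall x, a <= x <= b -> Rabs (p x - q x) <= M) ->
  Rabs (RInt p a b - RInt q a b) <= (b - a) * M.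
Proof.
  intros Hp Hq ab H.
  replace (RInt p a b - RInt q a b) with (RInt (fun x => minus (p x) (q x)) a b).
  - apply abs_RInt_le_const; auto. apply ex_RInt_cont. intros x.
    now apply (continuous_minus p q).
  - rewrite (RInt_minus p q) by now apply ex_RInt_cont. reflexivity.
Qed.

Lemma continuous_linear (C x : R) : continuous (fun y => C * y) x.
Proof.
  apply (continuous_mult (fun _ => C) (fun x => x));
    [apply continuous_const | apply continuous_id].
Qed.

Lemma RInt_linear (C z : R) : RInt (fun x => C * x) 0 z = C * z ^ 2 / 2.
Proof.
  apply is_RInt_unique.
  replace (C * z ^ 2 / 2) with (minus (C * z ^ 2 / 2) (C * 0 ^ 2 / 2))
    by (unfold minus, plus, opp; simpl; field).
  apply (is_RInt_derive (fun x => C * x ^ 2 / 2)).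
  - intros x _. auto_derive; [trivial | field].
  - intros x _. apply continuous_linear.
Qed.

Lemma RInt_diff_le_linear (p q : R -> R) (z C : R) :
  (forall x, continuous p x) -> (forall x, continuous q x) -> 0 <= z ->
  (forall x, 0 <= x <= z -> Rabs (p x - q x) <= C * x) ->
  Rabs (RInt p 0 z - RInt q 0 z) <= C * z ^ 2 / 2.
Proof.
  intros Hp Hq z0 H.
  replace (RInt p 0 z - RInt q 0 z) with (RInt (fun x => minus (p x) (q x)) 0 z).
  - rewrite <- RInt_linear.
    assert (Hc : forall x, continuous (fun x => minus (p x) (q x)) x).
    { intros x. now apply (continuous_minus p q). }
    eapply Rle_trans; [apply abs_RInt_le; [lra | now apply ex_RInt_cont] |].
    apply RInt_le; try lra.
    + apply ex_RInt_cont. intros x.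
      apply (continuous_comp (fun x => minus (p x) (q x)) Rabs); auto.
      apply continuous_Rabs.
    + apply ex_RInt_cont. intros; apply continuous_linear.
    + intros x Hx. apply H; lra.
  - rewrite (RInt_minus p q) by now apply ex_RInt_cont. reflexivity.
Qed.

Lemma RInt_bounds (p q1 q2 : R -> R) (a b : R) :
  (forall x, continuous p x) -> (forall x, continuous q1 x) ->
  (forall x, continuous q2 x) -> a <= b ->
  (forall x, a <= x <= b -> q1 x <= p x <= q2 x) ->
  RInt q1 a b <= RInt p a b <= RInt q2 a b.
Proof.
  intros Hp H1 H2 ab H.
  split; apply RInt_le; auto using ex_RInt_cont; intros x Hx; apply H; lra.
Qed.

Lemma RInt_const_R (a b c : R) : RInt (fun _ => c) a b = (b - a) * c.
Proof. rewrite RInt_const. reflexivity. Qed.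

(** * Gaussian integral *)

Definition gauss (t : R) : R := exp (- t ^ 2).

Lemma continuous_gauss (x : R) : continuous gauss x.
Proof. apply (ex_derive_continuous gauss). unfold gauss. auto_derive. trivial. Qed.

Definition gauss_aux (x t : R) : R := exp (- x ^ 2 * (1 + t ^ 2)) / (1 + t ^ 2).

Lemma is_derive_gauss_aux (x t : R) :
  is_derive (fun u => gauss_aux u t) x (- 2 * x * exp (- x ^ 2 * (1 + t ^ 2))).
Proof.
  unfold gauss_aux. auto_derive; [trivial |]. pose proof (pow2_ge_0 t). simpl in *.
  field. lra.
Qed.

Lemma continuous_gauss_aux (x t : R) : continuous (gauss_aux x) t.
Proof.
  apply (ex_derive_continuous (gauss_aux x)). unfold gauss_aux.
  auto_derive. pose proof (pow2_ge_0 t); simpl in *; lra.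
Qed.

(* [RInt (gauss_aux x) 0 1] is the companion making
   [RInt gauss 0 x ^ 2 + RInt (gauss_aux x) 0 1] constant, equal to [PI / 4]. *)
Lemma is_derive_RInt_gauss_aux (x : R) :
  is_derive (fun x => RInt (gauss_aux x) 0 1) x (- 2 * gauss x * RInt gauss 0 x).
Proof.
  replace (- 2 * gauss x * RInt gauss 0 x)
    with (RInt (fun t => Derive (fun u => gauss_aux u t) x) 0 1).
  - apply (is_derive_RInt_param gauss_aux 0 1 x).
    + apply filter_forall. intros y t _. eexists. apply is_derive_gauss_aux.
    + intros t _.
      apply continuity_2d_pt_ext with
        (f := fun u v => - 2 * u * exp (- u ^ 2 * (1 + v ^ 2))).
      { intros u v. symmetry. apply is_derive_unique, is_derive_gauss_aux. }
      apply continuity_2d_pt_mult.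
      * apply continuity_2d_pt_mult; [apply continuity_2d_pt_const | apply continuity_2d_pt_id1].
      * apply (continuity_1d_2d_pt_comp exp (fun u v => - u ^ 2 * (1 + v ^ 2))).
        { apply derivable_continuous_pt, derivable_pt_exp. }
        apply continuity_2d_pt_mult.
        -- apply continuity_2d_pt_opp. simpl.
           repeat apply continuity_2d_pt_mult; try apply continuity_2d_pt_const; apply continuity_2d_pt_id1.
        -- apply continuity_2d_pt_plus; [apply continuity_2d_pt_const |]. simpl.
           repeat apply continuity_2d_pt_mult; try apply continuity_2d_pt_const; apply continuity_2d_pt_id2.
    + apply filter_forall. intros y. apply ex_RInt_cont, continuous_gauss_aux.
  - rewrite (RInt_ext _ (fun t => scal (- 2 * gauss x) (x * gauss (x * t + 0)))).
    2: { intros t _. etransitivity; [apply is_derive_unique, is_derive_gauss_aux |].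
         unfold gauss, scal; simpl; unfold mult; simpl.
         replace (- (x * (x * 1)) * (1 + t * (t * 1)))
           with (- (x * (x * 1)) + - ((x * t + 0) * ((x * t + 0) * 1))) by ring.
         rewrite exp_plus. ring. }
    rewrite (RInt_scal (fun t => x * gauss (x * t + 0))).
    2: { apply ex_RInt_cont. intros t.
         apply (ex_derive_continuous (fun t => x * gauss (x * t + 0))).
         unfold gauss. auto_derive. trivial. }
    pose proof (RInt_comp_lin gauss x 0 0 1 (ex_RInt_cont _ _ _ continuous_gauss)) as E.
    unfold scal in *; simpl in *; unfold mult in *; simpl in *. rewrite E.
    do 2 f_equal; ring.
Qed.

Lemma RInt_gauss_sqr_le (x : R) : 0 <= x -> RInt gauss 0 x ^ 2 <= PI / 4.
Proof.
  intros x0.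
  set (S := fun x => RInt gauss 0 x ^ 2 + RInt (gauss_aux x) 0 1).
  assert (HS : forall y, is_derive S y zero).
  { intros y. unfold S. evar_last.
    - apply (is_derive_plus (fun x => RInt gauss 0 x ^ 2) (fun x => RInt (gauss_aux x) 0 1)).
      + apply (is_derive_pow (RInt gauss 0)), is_derive_RInt_cont, continuous_gauss.
      + apply is_derive_RInt_gauss_aux.
    - unfold plus, zero; simpl. ring. }
  assert (S0 : S 0 = PI / 4).
  { unfold S. rewrite RInt_point. unfold zero; simpl.
    rewrite (RInt_ext _ (fun t => / (1 + Rsqr t))).
    2: { intros t _. unfold gauss_aux, Rsqr. replace (- 0 ^ 2 * (1 + t ^ 2)) with 0 by ring.
         rewrite exp_0. simpl. rewrite Rmult_1_r. unfold Rdiv. apply Rmult_1_l. }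
    rewrite (is_RInt_unique _ 0 1 (minus (atan 1) (atan 0))).
    { rewrite atan_0, atan_1. unfold minus, plus, opp; simpl. ring. }
    apply (is_RInt_derive atan (fun t => / (1 + Rsqr t))).
    - intros t _. apply is_derive_atan.
    - intros t _. apply (ex_derive_continuous (fun t => / (1 + Rsqr t))).
      unfold Rsqr. auto_derive. nra. }
  assert (Sx : S x = PI / 4).
  { destruct x0 as [x0 | <-]; [| exact S0]. rewrite <- S0. symmetry.
    apply (eq_is_derive S 0 x); auto. }
  unfold S in Sx. assert (0 <= RInt (gauss_aux x) 0 1).
  { apply RInt_ge_0; [lra | apply ex_RInt_cont, continuous_gauss_aux |].
    intros t _. unfold gauss_aux. left. apply Rdiv_lt_0_compat; [apply exp_pos |].
    pose proof (pow2_ge_0 t); lra. }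
  lra.
Qed.

Lemma RInt_gauss_le (a b : R) : RInt gauss a b <= sqrt PI.
Proof.
  assert (half : forall x, Rabs (RInt gauss 0 x) <= sqrt PI / 2).
  { assert (pos : forall x, 0 <= x -> Rabs (RInt gauss 0 x) <= sqrt PI / 2).
    { intros x x0. pose proof (RInt_gauss_sqr_le x x0) as H.
      pose proof (sqrt_sqrt PI (Rlt_le _ _ PI_RGT_0)).
      pose proof (sqrt_pos PI).
      apply Rsqr_incr_0; [| apply Rabs_pos | lra].
      rewrite <- Rsqr_abs. unfold Rsqr. nra. }
    intros x. destruct (Rle_dec 0 x) as [x0 | x0]; [auto |].
    pose proof (RInt_comp_lin gauss (- 1) 0 0 (- x) (ex_RInt_cont _ _ _ continuous_gauss)) as E.
    replace (- 1 * 0 + 0) with 0 in E by ring.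
    replace (- 1 * - x + 0) with x in E by ring. rewrite <- E.
    rewrite (RInt_ext _ (fun y => opp (gauss y))).
    - rewrite (RInt_opp gauss) by apply ex_RInt_cont, continuous_gauss.
      unfold opp; simpl. rewrite Rabs_Ropp. apply pos; lra.
    - intros y _. unfold gauss, scal, opp; simpl; unfold mult; simpl.
      replace ((- 1 * y + 0) * ((- 1 * y + 0) * 1)) with (y * (y * 1)) by ring. ring. }
  rewrite <- (RInt_minus_from gauss 0 a b) by apply continuous_gauss.
  pose proof (half a) as Ha. pose proof (half b) as Hb.
  apply Rabs_le_between in Ha. apply Rabs_le_between in Hb. lra.
Qed.

Lemma RInt_exp_quadratic_le (c n lam : R) :
  0 < n -> RInt (fun z => exp (2 * z * c - z ^ 2 * n)) 0 lam
           <= exp (c ^ 2 / n) * sqrt PI / sqrt n.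
Proof.
  intros n0. pose proof (sqrt_lt_R0 n n0) as sn0.
  pose proof (sqrt_sqrt n (Rlt_le _ _ n0)) as nn.
  set (s := sqrt n) in *.
  pose proof (RInt_comp_lin gauss s (- (c / s)) 0 lam (ex_RInt_cont _ _ _ continuous_gauss)) as E.
  rewrite (RInt_ext _ (fun z => scal (exp (c ^ 2 / n) / s) (scal s (gauss (s * z + - (c / s)))))).
  - rewrite (RInt_scal (fun z => scal s (gauss (s * z + - (c / s))))).
    + refine (Rle_trans _ _ _ (Req_le _ _ (f_equal (Rmult (exp (c ^ 2 / n) / s)) E)) _).
      unfold Rdiv. rewrite !Rmult_assoc. rewrite (Rmult_comm (sqrt PI)).
      rewrite <- !Rmult_assoc. apply Rmult_le_compat_l; [| apply RInt_gauss_le].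
      left. apply Rmult_lt_0_compat; [apply exp_pos | now apply Rinv_0_lt_compat].
    + apply ex_RInt_cont. intros z.
      apply (ex_derive_continuous (fun z => scal s (gauss (s * z + - (c / s))))).
      unfold gauss, scal; simpl; unfold mult; simpl. auto_derive. trivial.
  - intros z _. unfold gauss, scal; simpl; unfold mult; simpl. rewrite <- nn.
    replace (exp (c * (c * 1) / (s * s)) / s *
      (s * exp (- ((s * z + - (c / s)) * ((s * z + - (c / s)) * 1)))))
      with (exp (c * (c * 1) / (s * s)) *
        exp (- ((s * z + - (c / s)) * ((s * z + - (c / s)) * 1)))) by (field; lra).
    rewrite <- exp_plus. f_equal. field. lra.
Qed.

(** * Fixed points *)

Lemma geometric_bound (g : R -> R) (C q : R) :
  0 <= q < 1 -> 0 <= C -> (forall x, g x <= 1) ->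
  (forall delta, 0 <= delta -> (forall x, g x <= delta) ->
     forall x, g x <= C + q * delta) ->
  forall x, g x <= C / (1 - q).
Proof.
  intros Hq HC H1 Hstep x.
  assert (Hn : forall n y, g y <= C / (1 - q) + q ^ n).
  { assert (0 <= C / (1 - q)) by (apply Rcomplements.Rdiv_le_0_compat; lra).
    induction n as [| n IH]; intros y.
    - simpl. specialize (H1 y). lra.
    - assert (0 <= q ^ n) by (apply pow_le; lra).
      pose proof (Hstep (C / (1 - q) + q ^ n) ltac:(lra) IH y) as Hy.
      replace (C / (1 - q) + q ^ S n) with (C + q * (C / (1 - q) + q ^ n))
        by (simpl; field; lra).
      exact Hy. }
  apply (is_lim_seq_le (fun _ => g x) (fun n => C / (1 - q) + q ^ n) (g x) (C / (1 - q))).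
  - intros n. apply Hn.
  - apply is_lim_seq_const.
  - replace (C / (1 - q)) with (C / (1 - q) + 0) at 1 by ring.
    apply is_lim_seq_plus'; [apply is_lim_seq_const |].
    apply is_lim_seq_geom. rewrite Rabs_pos_eq; lra.
Qed.

Definition unit_lipschitz (K : R) (f : R -> R) : Prop :=
  (forall x, 0 <= f x <= 1) /\ (forall x y, Rabs (f x - f y) <= K * Rabs (x - y)).

(* Lipschitz functions with a fixed constant are stable under pointwise limits,
   so pointwise convergence of the Picard iterates suffices. *)
Lemma lipschitz_contraction_fixed_point (P : (R -> R) -> R -> R) (K q : R) :
  0 <= K -> 0 <= q < 1 ->
  (forall f, unit_lipschitz K f -> unit_lipschitz K (P f)) ->
  (forall f g delta, unit_lipschitz K f -> unit_lipschitz K g -> 0 <= delta ->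
     (forall x, Rabs (f x - g x) <= delta) ->
     forall x, Rabs (P f x - P g x) <= q * delta) ->
  {f | unit_lipschitz K f /\ forall x, P f x = f x}.
Proof.
  intros HK Hq Hstab Hcontr.
  set (u := fun n => Nat.iter n P (fun _ => 0)).
  assert (Hu : forall n, unit_lipschitz K (u n)).
  { induction n as [| n IH]; [| exact (Hstab _ IH)].
    split; simpl; intros; [lra |].
    rewrite Rminus_diag, Rabs_R0. apply Rmult_le_pos; [trivial | apply Rabs_pos]. }
  assert (Hqn : forall n, 0 <= q ^ n) by (intros n; apply pow_le; lra).
  assert (Hd : forall n k x, Rabs (u (n + k)%nat x - u n x) <= q ^ n).
  { induction n as [| n IH]; intros k x.
    - destruct (Hu (0 + k)%nat) as [H1 _], (Hu 0%nat) as [H0 _].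
      specialize (H1 x). specialize (H0 x). apply Rabs_le. simpl in *; lra.
    - exact (Hcontr _ _ (q ^ n) (Hu _) (Hu _) (Hqn n) (IH k) x). }
  assert (Hlim : forall x, is_lim_seq (fun n => u n x) (real (Lim_seq (fun n => u n x)))).
  { intros x. apply Lim_seq_correct', ex_lim_seq_cauchy_corr. intros e.
    assert (Hg : is_lim_seq (fun n => q ^ n) 0)
      by (apply is_lim_seq_geom; rewrite Rabs_pos_eq; lra).
    apply is_lim_seq_spec in Hg.
    assert (e2 : 0 < e / 2) by (pose proof (cond_pos e); lra).
    destruct (Hg (mkposreal _ e2)) as [N HN]. exists N. intros n m Hn Hm.
    specialize (HN N (Nat.le_refl N)). simpl in HN.
    rewrite Rminus_0_r, Rabs_pos_eq in HN by auto.
    pose proof (Hd N (n - N)%nat x) as A1. pose proof (Hd N (m - N)%nat x) as A2.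
    rewrite Nat.add_comm, Nat.sub_add in A1, A2 by trivial.
    replace (u n x - u m x) with ((u n x - u N x) - (u m x - u N x)) by ring.
    eapply Rle_lt_trans; [apply Rabs_triang |]. rewrite Rabs_Ropp. lra. }
  set (f := fun x => real (Lim_seq (fun n => u n x))) in *.
  assert (Hf : unit_lipschitz K f).
  { split.
    - intros x. split.
      + apply (is_lim_seq_le (fun _ => 0) (fun n => u n x) 0 (f x)); auto using is_lim_seq_const.
        intros n. apply (Hu n).
      + apply (is_lim_seq_le (fun n => u n x) (fun _ => 1) (f x) 1); auto using is_lim_seq_const.
        intros n. apply (Hu n).
    - intros x y.
      apply (is_lim_seq_le (fun n => Rabs (u n x - u n y)) (fun _ => K * Rabs (x - y))
               (Rabs (f x - f y)) (K * Rabs (x - y))); auto using is_lim_seq_const.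
      + intros n. apply (Hu n).
      + apply (is_lim_seq_abs _ (f x - f y)). apply is_lim_seq_minus'; apply Hlim. }
  exists f. split; [trivial |].
  assert (Hfn : forall n x, Rabs (f x - u n x) <= q ^ n).
  { intros n x.
    apply (is_lim_seq_le (fun k => Rabs (u (k + n)%nat x - u n x)) (fun _ => q ^ n)
             (Rabs (f x - u n x)) (q ^ n)); auto using is_lim_seq_const.
    - intros k. rewrite Nat.add_comm. apply Hd.
    - apply (is_lim_seq_abs _ (f x - u n x)). apply is_lim_seq_minus'; [| apply is_lim_seq_const].
      apply (is_lim_seq_incr_n (fun k => u k x)), Hlim. }
  intros x.
  assert (HPf : is_lim_seq (fun n => u (S n) x) (P f x)).
  { apply is_lim_seq_spec. intros e.
    assert (Hg : is_lim_seq (fun n => q ^ n) 0)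
      by (apply is_lim_seq_geom; rewrite Rabs_pos_eq; lra).
    apply is_lim_seq_spec in Hg. destruct (Hg e) as [N HN]. exists N. intros n Hn.
    specialize (HN n Hn). rewrite Rminus_0_r, Rabs_pos_eq in HN by auto.
    rewrite Rabs_minus_sym. eapply Rle_lt_trans; [| exact HN].
    pose proof (Hcontr f (u n) (q ^ n) Hf (Hu n) (Hqn n) (Hfn n) x) as H.
    pose proof (Hqn n). simpl. nra. }
  apply is_lim_seq_unique in HPf.
  pose proof (is_lim_seq_unique (fun n => u (S n) x) (f x)
    (proj1 (is_lim_seq_incr_1 _ _) (Hlim x))) as E.
  rewrite HPf in E. now injection E.
Qed.

(** * Projection onto a segment *)

Definition clamp (lam x : R) : R := Rmax 0 (Rmin x lam).

Lemma clamp_segment (lam x : R) : 0 <= lam -> 0 <= clamp lam x <= lam.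
Proof.
  intros. unfold clamp. split; [apply Rmax_l |].
  apply Rmax_lub; [trivial | apply Rmin_r].
Qed.

Lemma clamp_id (lam x : R) : 0 <= x <= lam -> clamp lam x = x.
Proof. intros. unfold clamp. rewrite Rmin_left, Rmax_right; lra. Qed.

Lemma clamp_lipschitz (lam x y : R) :
  0 <= lam -> Rabs (clamp lam x - clamp lam y) <= Rabs (x - y).
Proof.
  intros. unfold clamp, Rmax, Rmin.
  repeat destruct Rle_dec; unfold Rabs; repeat destruct Rcase_abs; lra.
Qed.

Lemma clamp_lipschitz_bound (lam1 lam2 x : R) :
  0 <= lam1 -> 0 <= lam2 -> Rabs (clamp lam1 x - clamp lam2 x) <= Rabs (lam1 - lam2).
Proof.
  intros. unfold clamp, Rmax, Rmin.
  repeat destruct Rle_dec; unfold Rabs; repeat destruct Rcase_abs; lra.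
Qed.

Lemma continuous_clamp (lam x : R) : 0 <= lam -> continuous (clamp lam) x.
Proof.
  intros. apply (continuous_at_of_le _ 1). intros a. rewrite Rmult_1_l.
  now apply clamp_lipschitz.
Qed.

Lemma continuous_comp_clamp (lam : R) (f : R -> R) (x : R) :
  0 <= lam -> continuous_on (segment lam) f -> continuous (fun y => f (clamp lam y)) x.
Proof.
  intros H Hf P HP.
  specialize (Hf (clamp lam x) (clamp_segment lam x H) P HP).
  unfold filtermap, within in *.
  generalize (continuous_clamp lam x H _ Hf). unfold filtermap.
  apply filter_imp. intros y Hy. apply Hy. now apply clamp_segment.
Qed.

(** * Suprema *)

Lemma supnorm_le {A : Type} (D : A -> Prop) (g : A -> R) (M : R) :
  Rbar_le (supnorm D g) M <-> forall a, D a -> Rabs (g a) <= M.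
Proof.
  unfold supnorm. destruct (Lub_Rbar_correct (fun y => exists a, D a /\ y = Rabs (g a))) as [ub lub].
  split.
  - intros H a Ha. apply (Rbar_le_trans (Rabs (g a)) _ M (ub _ (ex_intro _ a (conj Ha eq_refl))) H).
  - intros H. apply lub. intros y (a & Ha & ->). simpl. auto.
Qed.

Lemma supnorm_const {A : Type} (D : A -> Prop) (a0 : A) (y : R) :
  D a0 -> supnorm D (fun _ => y) = Rabs y.
Proof.
  intros Ha0. apply is_lub_Rbar_unique. split.
  - intros x (a & _ & ->). apply Rle_refl.
  - intros b Hb. apply Hb. now exists a0.
Qed.

Lemma quadrant_inhabited : quadrant (0, 1).
Proof. unfold quadrant; simpl; lra. Qed.

Lemma in_C_const (y : R) : in_C (fun _ => y).
Proof.
  split.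
  - apply continuous_on_forall. intros. apply continuous_const.
  - now rewrite (supnorm_const quadrant _ y quadrant_inhabited).
Qed.

Lemma bounded_lipschitz_bounds (g : R -> R) (m M l : R) :
  bounded_lipschitz g m M l -> forall y, m <= g y <= M.
Proof. intros [H _] y. apply (H _ (in_C_const y) _ quadrant_inhabited). Qed.

Lemma bounded_lipschitz_lipschitz (g : R -> R) (m M l : R) :
  bounded_lipschitz g m M l -> forall y1 y2, Rabs (g y1 - g y2) <= l * Rabs (y1 - y2).
Proof.
  intros [_ H] y1 y2. specialize (H _ _ (in_C_const y1) (in_C_const y2)). cbv beta in H.
  now rewrite !(supnorm_const quadrant _ _ quadrant_inhabited) in H.
Qed.

(** * Nonnegative nondecreasing functions *)

Definition nonneg_incr (f : R -> R) : Prop := forall x y, 0 <= x <= y -> 0 <= f x <= f y.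

Lemma nonneg_incr_const (c : R) : 0 <= c -> nonneg_incr (fun _ => c).
Proof. intros c0 x y _. lra. Qed.

Lemma nonneg_incr_id : nonneg_incr (fun x => x).
Proof. intros x y Hx. lra. Qed.

Lemma nonneg_incr_plus (f g : R -> R) :
  nonneg_incr f -> nonneg_incr g -> nonneg_incr (fun x => f x + g x).
Proof. intros Hf Hg x y Hx. specialize (Hf x y Hx). specialize (Hg x y Hx). lra. Qed.

Lemma nonneg_incr_mult (f g : R -> R) :
  nonneg_incr f -> nonneg_incr g -> nonneg_incr (fun x => f x * g x).
Proof.
  intros Hf Hg x y Hx. specialize (Hf x y Hx). specialize (Hg x y Hx).
  split; [apply Rmult_le_pos | apply Rmult_le_compat]; lra.
Qed.

Lemma nonneg_incr_exp (f : R -> R) : nonneg_incr f -> nonneg_incr (fun x => exp (f x)).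
Proof.
  intros Hf x y Hx. split; [left; apply exp_pos | apply exp_le, Hf, Hx].
Qed.

Lemma nonneg_incr_pow (f : R -> R) (n : nat) :
  nonneg_incr f -> nonneg_incr (fun x => f x ^ n).
Proof.
  intros Hf. induction n as [| n IH]; simpl.
  - apply nonneg_incr_const; lra.
  - now apply nonneg_incr_mult.
Qed.

(** * The integral operators *)

Section Data.

Context {d : stefan_data} (Hpos : positive_data).

Lemma constants_pos :
  (0 < L_m /\ 0 < L_M /\ 0 < L_tilde) /\ (0 < N_m /\ 0 < N_M /\ 0 < N_tilde) /\
  (0 < mu_m /\ 0 < mu_M /\ 0 < mu_tilde) /\
  (0 < alpha0 /\ 0 < Ste /\ 0 < Bi /\ 0 < rad /\ 0 < D5).
Proof.
  destruct Hpos.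
  assert (0 < alpha0) by (unfold alpha0; apply Rdiv_lt_0_compat; nra).
  assert (0 < sqrt alpha0) by now apply sqrt_lt_R0.
  assert (0 < rho0 * c0) by nra.
  assert (0 < rho0 * c0 * k0) by nra.
  assert (0 < sqrt (rho0 * c0 * k0)) by now apply sqrt_lt_R0.
  assert (0 < Tstar - Tm) by lra.
  unfold L_m, L_M, L_tilde, N_m, N_M, N_tilde, mu_m, mu_M, mu_tilde, Ste, Bi, rad, D5.
  rewrite Rabs_pos_eq by lra.
  repeat split; try assumption; try apply Rdiv_lt_0_compat;
    repeat apply Rmult_lt_0_compat; try apply pow_lt; lra.
Qed.

Ltac positive_constants :=
  destruct constants_pos as ((? & ? & ?) & (? & ? & ?) & (? & ? & ?) & ? & ? & ? & ? & ?).

Lemma div_lipschitz (g : R -> R) (l c a b : R) :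
  0 < c -> (forall y1 y2, Rabs (g y1 - g y2) <= l * Rabs (y1 - y2)) ->
  Rabs (g (temp a) / c - g (temp b) / c) <= l * (Tstar - Tm) / c * Rabs (a - b).
Proof.
  intros c0 H. replace (g (temp a) / c - g (temp b) / c)
    with ((g (temp a) - g (temp b)) * / c) by (field; lra).
  pose proof (Rinv_0_lt_compat c c0).
  rewrite Rabs_mult, (Rabs_pos_eq (/ c)) by lra.
  replace (l * (Tstar - Tm) / c * Rabs (a - b))
    with (l * ((Tstar - Tm) * Rabs (a - b)) * / c) by (field; lra).
  apply Rmult_le_compat_r; [lra |].
  replace ((Tstar - Tm) * Rabs (a - b)) with (Rabs (temp a - temp b)); [apply H |].
  unfold temp. replace ((Tm - Tstar) * a + Tstar - ((Tm - Tstar) * b + Tstar))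
    with (- ((Tstar - Tm) * (a - b))) by ring.
  rewrite Rabs_Ropp, Rabs_mult, Rabs_pos_eq; [trivial |]. destruct Hpos; lra.
Qed.

Context (HK : hyp_K) (HR : hyp_R) (HV : hyp_V).

Lemma Lstar_bounds (f : R -> R) (x : R) : L_m <= Lstar f x <= L_M.
Proof.
  apply div_bounds; [apply Hpos | apply (bounded_lipschitz_bounds _ _ _ _ HK)].
Qed.

Lemma Nstar_bounds (f : R -> R) (x : R) : N_m <= Nstar f x <= N_M.
Proof.
  apply div_bounds; [destruct Hpos; nra |].
  apply (bounded_lipschitz_bounds _ _ _ _ HR (temp (f x))).
Qed.

Lemma sqrt_data_pos : 0 < sqrt (rho0 * c0 * k0).
Proof. destruct Hpos. apply sqrt_lt_R0. assert (0 < rho0 * c0) by nra. nra. Qed.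

Lemma mustar_bounds (f : R -> R) (x : R) : mu_m <= mustar f x <= mu_M.
Proof.
  apply div_bounds; [apply sqrt_data_pos | apply (bounded_lipschitz_bounds _ _ _ _ HV)].
Qed.

Lemma Lstar_lipschitz (f g : R -> R) (x y : R) :
  Rabs (Lstar f x - Lstar g y) <= L_tilde * Rabs (f x - g y).
Proof.
  apply (div_lipschitz coef_k); [apply Hpos | apply (bounded_lipschitz_lipschitz _ _ _ _ HK)].
Qed.

Lemma Nstar_lipschitz (f g : R -> R) (x y : R) :
  Rabs (Nstar f x - Nstar g y) <= N_tilde * Rabs (f x - g y).
Proof.
  apply (div_lipschitz (fun y => coef_rho y * coef_c y)); [destruct Hpos; nra |].
  apply (bounded_lipschitz_lipschitz _ _ _ _ HR).
Qed.

Lemma mustar_lipschitz (f g : R -> R) (x y : R) :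
  Rabs (mustar f x - mustar g y) <= mu_tilde * Rabs (f x - g y).
Proof.
  apply (div_lipschitz coef_mu);
    [apply sqrt_data_pos | apply (bounded_lipschitz_lipschitz _ _ _ _ HV)].
Qed.

Lemma continuous_Lstar (f : R -> R) (x : R) : continuous f x -> continuous (Lstar f) x.
Proof. apply continuous_of_dominated with L_tilde. intros. apply Lstar_lipschitz. Qed.

Lemma continuous_Nstar (f : R -> R) (x : R) : continuous f x -> continuous (Nstar f) x.
Proof. apply continuous_of_dominated with N_tilde. intros. apply Nstar_lipschitz. Qed.

Lemma continuous_mustar (f : R -> R) (x : R) : continuous f x -> continuous (mustar f) x.
Proof. apply continuous_of_dominated with mu_tilde. intros. apply mustar_lipschitz. Qed.

Lemma Lstar_pos (f : R -> R) (x : R) : 0 < Lstar f x.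
Proof. positive_constants. pose proof (Lstar_bounds f x). lra. Qed.

Lemma continuous_mu_div_L (f : R -> R) (x : R) :
  continuous f x -> continuous (fun y => mustar f y / Lstar f y) x.
Proof.
  intros Hf. pose proof (Lstar_pos f x).
  apply continuous_div; [now apply continuous_mustar | now apply continuous_Lstar | lra].
Qed.

Lemma continuous_N_div_L (f : R -> R) (x : R) :
  continuous f x -> continuous (fun y => y * Nstar f y / Lstar f y) x.
Proof.
  intros Hf. pose proof (Lstar_pos f x).
  apply continuous_div; [| now apply continuous_Lstar | lra].
  apply (continuous_mult (fun y => y) (Nstar f)); [apply continuous_id | now apply continuous_Nstar].
Qed.

Definition expU (z : R) : R := exp (2 * (mu_M / L_m) * z).
Definition expI (z : R) : R := exp (N_M / L_m * z ^ 2).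

Lemma mu_div_L_bounds (f : R -> R) (x : R) : 0 <= mustar f x / Lstar f x <= mu_M / L_m.
Proof.
  positive_constants. pose proof (mustar_bounds f x).
  replace 0 with (0 / L_M) by (unfold Rdiv; ring).
  apply quotient_bounds; try lra. apply Lstar_bounds.
Qed.

Lemma N_div_L_bounds (f : R -> R) (x : R) :
  0 <= x -> N_m / L_M * x <= x * Nstar f x / Lstar f x <= N_M / L_m * x.
Proof.
  positive_constants. intros x0. pose proof (Nstar_bounds f x).
  destruct (quotient_bounds (Nstar f x) N_m N_M (Lstar f x) L_m L_M) as [A B];
    try lra; [apply Lstar_bounds |].
  replace (x * Nstar f x / Lstar f x) with (Nstar f x / Lstar f x * x)
    by (unfold Rdiv; ring).
  split; apply Rmult_le_compat_r; lra.
Qed.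

Lemma mu_div_L_lipschitz (f g : R -> R) (delta x : R) :
  Rabs (f x - g x) <= delta ->
  Rabs (mustar f x / Lstar f x - mustar g x / Lstar g x)
  <= (mu_M * L_tilde + L_m * mu_tilde) / L_m ^ 2 * delta.
Proof.
  intros H. positive_constants.
  pose proof (Lstar_bounds f x). pose proof (Lstar_bounds g x).
  pose proof (mustar_bounds g x).
  pose proof (Lstar_lipschitz f g x x). pose proof (mustar_lipschitz f g x x).
  replace ((mu_M * L_tilde + L_m * mu_tilde) / L_m ^ 2 * delta)
    with ((mu_M * (L_tilde * delta) + L_m * (mu_tilde * delta)) / L_m ^ 2) by (field; lra).
  apply quotient_diff_le; try lra; eapply Rle_trans; try eassumption;
    apply Rmult_le_compat_l; lra.
Qed.

Lemma N_div_L_lipschitz (f g : R -> R) (delta x : R) :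
  0 <= x -> Rabs (f x - g x) <= delta ->
  Rabs (x * Nstar f x / Lstar f x - x * Nstar g x / Lstar g x)
  <= (N_M * L_tilde + L_m * N_tilde) / L_m ^ 2 * delta * x.
Proof.
  intros x0 H. positive_constants.
  pose proof (Lstar_bounds f x). pose proof (Lstar_bounds g x).
  pose proof (Nstar_bounds g x).
  pose proof (Lstar_lipschitz f g x x). pose proof (Nstar_lipschitz f g x x).
  replace (x * Nstar f x / Lstar f x - x * Nstar g x / Lstar g x)
    with ((Nstar f x / Lstar f x - Nstar g x / Lstar g x) * x) by (field; lra).
  rewrite Rabs_mult, (Rabs_pos_eq x) by trivial. apply Rmult_le_compat_r; [trivial |].
  replace ((N_M * L_tilde + L_m * N_tilde) / L_m ^ 2 * delta)
    with ((N_M * (L_tilde * delta) + L_m * (N_tilde * delta)) / L_m ^ 2) by (field; lra).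
  apply quotient_diff_le; try lra; eapply Rle_trans; try eassumption;
    apply Rmult_le_compat_l; lra.
Qed.

Lemma intU_bounds (f : R -> R) (z : R) :
  (forall x, continuous f x) -> 0 <= z ->
  0 <= 2 * RInt (fun y => mustar f y / Lstar f y) 0 z <= 2 * (mu_M / L_m) * z.
Proof.
  intros Hf z0.
  destruct (RInt_bounds (fun y => mustar f y / Lstar f y) (fun _ => 0) (fun _ => mu_M / L_m) 0 z)
    as [A B]; auto using continuous_const, continuous_mu_div_L, mu_div_L_bounds.
  rewrite RInt_const_R in A, B. lra.
Qed.

Lemma intI_bounds (f : R -> R) (z : R) :
  (forall x, continuous f x) -> 0 <= z ->
  N_m / L_M * z ^ 2 <= 2 * RInt (fun y => y * Nstar f y / Lstar f y) 0 z <= N_M / L_m * z ^ 2.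
Proof.
  intros Hf z0.
  destruct (RInt_bounds (fun y => y * Nstar f y / Lstar f y)
    (fun y => N_m / L_M * y) (fun y => N_M / L_m * y) 0 z)
    as [A B]; auto using continuous_linear, continuous_N_div_L.
  - intros x Hx. apply N_div_L_bounds. lra.
  - rewrite RInt_linear in A, B. lra.
Qed.

Lemma opU_bounds (f : R -> R) (z : R) :
  (forall x, continuous f x) -> 0 <= z -> 1 <= opU f z <= expU z.
Proof.
  intros Hf z0. pose proof (intU_bounds f z Hf z0). unfold opU, expU.
  split; [apply exp_ge_1 | apply exp_le]; lra.
Qed.

Lemma opI_bounds (f : R -> R) (z : R) :
  (forall x, continuous f x) -> 0 <= z -> exp (N_m / L_M * z ^ 2) <= opI f z <= expI z.
Proof.
  intros Hf z0. pose proof (intI_bounds f z Hf z0). unfold opI, expI.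
  split; apply exp_le; lra.
Qed.

Lemma opI_ge_1 (f : R -> R) (z : R) :
  (forall x, continuous f x) -> 0 <= z -> 1 <= opI f z.
Proof.
  intros Hf z0. positive_constants. pose proof (opI_bounds f z Hf z0).
  assert (1 <= exp (N_m / L_M * z ^ 2)); [| lra].
  apply exp_ge_1, Rmult_le_pos; [| apply pow2_ge_0].
  left. now apply Rdiv_lt_0_compat.
Qed.

Lemma opE_pos (f : R -> R) (z : R) : 0 < opE f z.
Proof. apply Rdiv_lt_0_compat; apply exp_pos. Qed.

Lemma opE_le (f : R -> R) (z : R) :
  (forall x, continuous f x) -> 0 <= z ->
  opE f z <= exp (2 * z * (mu_M / L_m) - z ^ 2 * (N_m / L_M)).
Proof.
  intros Hf z0. unfold opE, opU, opI, Rdiv at 1. rewrite <- exp_Ropp, <- exp_plus.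
  pose proof (intU_bounds f z Hf z0). pose proof (intI_bounds f z Hf z0).
  apply exp_le. lra.
Qed.

Lemma opE_le_expU (f : R -> R) (z : R) :
  (forall x, continuous f x) -> 0 <= z -> opE f z <= expU z.
Proof.
  intros Hf z0. pose proof (opU_bounds f z Hf z0). pose proof (opI_ge_1 f z Hf z0).
  unfold opE. apply Rle_div_l; [lra |]. nra.
Qed.

Lemma opU_lipschitz (f g : R -> R) (delta z : R) :
  (forall x, continuous f x) -> (forall x, continuous g x) -> 0 <= z ->
  (forall x, Rabs (f x - g x) <= delta) ->
  Rabs (opU f z - opU g z) <= D1 z * delta.
Proof.
  intros Hf Hg z0 H. positive_constants.
  unfold opU. eapply Rle_trans.
  { apply (exp_diff_le _ _ (2 * (mu_M / L_m) * z)); apply intU_bounds; trivial. }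
  rewrite <- Rmult_minus_distr_l, Rabs_mult, (Rabs_pos_eq 2) by lra.
  replace (D1 z * delta) with (exp (2 * (mu_M / L_m) * z) *
    (2 * ((z - 0) * ((mu_M * L_tilde + L_m * mu_tilde) / L_m ^ 2 * delta)))).
  2: { unfold D1. replace (2 * mu_M * z / L_m) with (2 * (mu_M / L_m) * z) by (field; lra).
       field; lra. }
  apply Rmult_le_compat_l; [left; apply exp_pos |]. apply Rmult_le_compat_l; [lra |].
  apply RInt_diff_le; auto using continuous_mu_div_L, mu_div_L_lipschitz.
Qed.

Lemma opI_lipschitz (f g : R -> R) (delta z : R) :
  (forall x, continuous f x) -> (forall x, continuous g x) -> 0 <= z ->
  (forall x, Rabs (f x - g x) <= delta) ->
  Rabs (opI f z - opI g z) <= D2 z * delta.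
Proof.
  intros Hf Hg z0 H. positive_constants.
  unfold opI. eapply Rle_trans.
  { apply (exp_diff_le _ _ (N_M / L_m * z ^ 2)); apply intI_bounds; trivial. }
  rewrite <- Rmult_minus_distr_l, Rabs_mult, (Rabs_pos_eq 2) by lra.
  replace (D2 z * delta) with (exp (N_M / L_m * z ^ 2) *
    (2 * ((N_M * L_tilde + L_m * N_tilde) / L_m ^ 2 * delta * z ^ 2 / 2))).
  2: { unfold D2. replace (N_M * z ^ 2 / L_m) with (N_M / L_m * z ^ 2) by (field; lra).
       field; lra. }
  apply Rmult_le_compat_l; [left; apply exp_pos |]. apply Rmult_le_compat_l; [lra |].
  apply RInt_diff_le_linear; auto using continuous_N_div_L.
  intros x Hx. apply N_div_L_lipschitz; [lra | trivial].
Qed.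

Ltac nonneg_const :=
  repeat first [lra | apply Rlt_le, Rinv_0_lt_compat; try apply pow_lt
    | apply Rmult_le_pos | apply Rplus_le_le_0_compat].

Ltac nonneg_incr_tac :=
  repeat first [apply nonneg_incr_const; solve [nonneg_const] | apply nonneg_incr_id
    | apply nonneg_incr_plus | apply nonneg_incr_exp | apply nonneg_incr_mult
    | apply nonneg_incr_pow | assumption].

Lemma D3_nonneg_incr : nonneg_incr D3.
Proof.
  positive_constants.
  assert (nonneg_incr D1) by (unfold D1, Rdiv; nonneg_incr_tac).
  assert (nonneg_incr D2) by (unfold D2, Rdiv; nonneg_incr_tac).
  unfold D3, Rdiv; nonneg_incr_tac.
Qed.

Lemma D4_nonneg_incr : nonneg_incr D4.
Proof.
  positive_constants. pose proof D3_nonneg_incr. unfold D4, Rdiv; nonneg_incr_tac.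
Qed.

Lemma opE_lipschitz (f g : R -> R) (delta z : R) :
  (forall x, continuous f x) -> (forall x, continuous g x) -> 0 <= z ->
  (forall x, Rabs (f x - g x) <= delta) ->
  Rabs (opE f z - opE g z) <= D3 z * delta.
Proof.
  intros Hf Hg z0 H. positive_constants.
  pose proof (opU_bounds g z Hg z0).
  assert (HU := opU_lipschitz f g delta z Hf Hg z0 H).
  assert (HI := opI_lipschitz f g delta z Hf Hg z0 H).
  assert (1 <= expI z).
  { unfold expI. apply exp_ge_1, Rmult_le_pos; [| apply pow2_ge_0].
    left. now apply Rdiv_lt_0_compat. }
  eapply Rle_trans.
  { apply (quotient_diff_le _ _ _ _ (expU z) 1 (D1 z * delta) (D2 z * delta));
      auto using opI_ge_1; lra. }
  unfold D3. fold (expI z) (expU z).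
  assert (0 <= D1 z * delta) by (eapply Rle_trans; [apply Rabs_pos | exact HU]).
  assert (1 * (D1 z * delta) <= expI z * (D1 z * delta)) by (apply Rmult_le_compat_r; lra).
  lra.
Qed.

Definition flux (f : R -> R) (z : R) : R := opE f z / Lstar f z.

Lemma flux_lipschitz (f g : R -> R) (delta z : R) :
  (forall x, continuous f x) -> (forall x, continuous g x) -> 0 <= z ->
  (forall x, Rabs (f x - g x) <= delta) ->
  Rabs (flux f z - flux g z) <= D4 z * delta.
Proof.
  intros Hf Hg z0 H. positive_constants.
  pose proof (opE_pos g z). pose proof (opE_le_expU g z Hg z0).
  pose proof (Lstar_bounds f z). pose proof (Lstar_bounds g z).
  unfold flux. eapply Rle_trans.
  { apply (quotient_diff_le _ _ _ _ (expU z) L_m (D3 z * delta) (L_tilde * delta));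
      auto using opE_lipschitz; try lra.
    eapply Rle_trans; [apply Lstar_lipschitz |]. apply Rmult_le_compat_l; [lra | auto]. }
  right. unfold D4. replace (exp (2 * z * (mu_M / L_m))) with (expU z)
    by (unfold expU; f_equal; ring).
  field; lra.
Qed.

Lemma is_derive_opE (f : R -> R) (z : R) :
  (forall x, continuous f x) ->
  is_derive (opE f) z
    (opE f z * (2 * (mustar f z / Lstar f z) - 2 * (z * Nstar f z / Lstar f z))).
Proof.
  intros Hf.
  set (p := fun y => mustar f y / Lstar f y).
  set (q := fun y => y * Nstar f y / Lstar f y).
  assert (HE : forall z, opE f z = exp (2 * RInt p 0 z - 2 * RInt q 0 z)).
  { intros y. unfold opE, opU, opI, Rdiv at 1. rewrite <- exp_Ropp, <- exp_plus.
    reflexivity. }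
  apply (is_derive_ext (fun z => exp (2 * RInt p 0 z - 2 * RInt q 0 z))).
  { intros y. symmetry. apply HE. }
  rewrite HE.
  assert (Dp : is_derive (RInt p 0) z (p z))
    by (apply is_derive_RInt_cont; intros; now apply continuous_mu_div_L).
  assert (Dq : is_derive (RInt q 0) z (q z))
    by (apply is_derive_RInt_cont; intros; now apply continuous_N_div_L).
  evar_last.
  - apply (is_derive_comp exp (fun z => 2 * RInt p 0 z - 2 * RInt q 0 z)).
    + apply is_derive_exp.
    + apply (is_derive_minus (fun z => 2 * RInt p 0 z) (fun z => 2 * RInt q 0 z));
        apply is_derive_scal; eassumption.
  - unfold scal, minus, plus, opp; simpl; unfold mult; simpl. unfold p, q. ring.
Qed.

Lemma continuous_opE (f : R -> R) (z : R) :
  (forall x, continuous f x) -> continuous (opE f) z.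
Proof.
  intros Hf. apply (ex_derive_continuous (opE f)). eexists. now apply is_derive_opE.
Qed.

Lemma continuous_flux (f : R -> R) (z : R) :
  (forall x, continuous f x) -> continuous (flux f) z.
Proof.
  intros Hf. pose proof (Lstar_pos f z).
  apply continuous_div; [now apply continuous_opE | now apply continuous_Lstar | lra].
Qed.

Lemma flux_bounds (f : R -> R) (z : R) :
  (forall x, continuous f x) -> 0 <= z ->
  0 <= flux f z <= exp (2 * z * (mu_M / L_m) - z ^ 2 * (N_m / L_M)) / L_m.
Proof.
  intros Hf z0. positive_constants.
  replace 0 with (0 / L_M) by (unfold Rdiv; ring).
  apply quotient_bounds; try lra; [| apply Lstar_bounds].
  split; [apply Rlt_le, opE_pos | now apply opE_le].
Qed.

Lemma flux_le_expU (f : R -> R) (z : R) :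
  (forall x, continuous f x) -> 0 <= z -> flux f z <= expU z / L_m.
Proof.
  intros Hf z0. positive_constants.
  apply quotient_bounds with 0 L_M; try lra; [| apply Lstar_bounds].
  split; [apply Rlt_le, opE_pos | now apply opE_le_expU].
Qed.

Lemma expU_incr (y z : R) : y <= z -> expU y <= expU z.
Proof.
  intros yz. positive_constants. apply exp_le. apply Rmult_le_compat_l; [| trivial].
  apply Rlt_le, Rmult_lt_0_compat; [lra | now apply Rdiv_lt_0_compat].
Qed.

Lemma opPhi_minus (f : R -> R) (a b : R) :
  (forall x, continuous f x) -> opPhi f b - opPhi f a = RInt (flux f) a b.
Proof.
  intros Hf. apply (RInt_minus_from (flux f)). intros. now apply continuous_flux.
Qed.

Lemma is_derive_opPhi (f : R -> R) (x : R) :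
  (forall x, continuous f x) -> is_derive (opPhi f) x (flux f x).
Proof.
  intros Hf. apply (is_derive_RInt_cont (flux f)). intros. now apply continuous_flux.
Qed.

Lemma opPhi_0 (f : R -> R) : opPhi f 0 = 0.
Proof. apply (RInt_point (V := R_CompleteNormedModule)). Qed.

Lemma opPhi_increment (f : R -> R) (a b z : R) :
  (forall x, continuous f x) -> 0 <= a <= b -> b <= z ->
  0 <= opPhi f b - opPhi f a <= (b - a) * (expU z / L_m).
Proof.
  intros Hf Hab Hb. positive_constants. rewrite opPhi_minus by trivial.
  destruct (RInt_bounds (flux f) (fun _ => 0) (fun _ => expU z / L_m) a b) as [A B];
    auto using continuous_const, continuous_flux; try lra.
  - intros x Hx. split; [apply flux_bounds; auto; lra |].
    eapply Rle_trans; [apply flux_le_expU; auto; lra |].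
    apply Rmult_le_compat_r; [apply Rlt_le, Rinv_0_lt_compat; lra | apply expU_incr; lra].
  - rewrite RInt_const_R in A, B. lra.
Qed.

Lemma opPhi_lipschitz (f : R -> R) (a b z : R) :
  (forall x, continuous f x) -> 0 <= a <= z -> 0 <= b <= z ->
  Rabs (opPhi f a - opPhi f b) <= expU z / L_m * Rabs (a - b).
Proof.
  intros Hf Ha Hb. destruct (Rle_dec a b) as [ab | ba].
  - pose proof (opPhi_increment f a b z Hf ltac:(lra) ltac:(lra)).
    rewrite Rabs_minus_sym, (Rabs_minus_sym a), !Rabs_pos_eq; lra.
  - pose proof (opPhi_increment f b a z Hf ltac:(lra) ltac:(lra)).
    rewrite !Rabs_pos_eq; lra.
Qed.

Lemma opPhi_le_expU (f : R -> R) (z : R) :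
  (forall x, continuous f x) -> 0 <= z -> opPhi f z <= expU z / mu_M.
Proof.
  intros Hf z0. positive_constants.
  rewrite <- (Rminus_0_r (opPhi f z)), <- (opPhi_0 f), opPhi_minus by trivial.
  set (g := fun z => expU z / (2 * mu_M)).
  assert (Hg : RInt (fun z => expU z / L_m) 0 z = g z - g 0).
  { apply is_RInt_unique, (is_RInt_derive g).
    - intros x _. unfold g, expU. auto_derive; [trivial |]. field; lra.
    - intros x _. apply (ex_derive_continuous (fun z => expU z / L_m)).
      unfold expU. auto_derive. trivial. }
  destruct (RInt_bounds (flux f) (fun _ => 0) (fun z => expU z / L_m) 0 z) as [_ B];
    auto using continuous_const, continuous_flux.
  - intros x. apply (ex_derive_continuous (fun z => expU z / L_m)).
    unfold expU. auto_derive. trivial.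
  - intros x Hx. split; [apply flux_bounds | apply flux_le_expU]; auto; lra.
  - rewrite Hg in B. eapply Rle_trans; [exact B |].
    unfold g.
    assert (0 < expU z) by apply exp_pos. assert (0 < expU 0) by apply exp_pos.
    assert (0 < / mu_M) by now apply Rinv_0_lt_compat.
    replace (expU z / (2 * mu_M) - expU 0 / (2 * mu_M))
      with ((expU z - expU 0) / 2 * / mu_M) by (field; lra).
    apply Rmult_le_compat_r; lra.
Qed.

Lemma opPhi_le_gauss (f : R -> R) (z : R) :
  (forall x, continuous f x) -> 0 <= z ->
  opPhi f z <= exp ((mu_M / L_m) ^ 2 / (N_m / L_M)) * sqrt PI / sqrt (N_m / L_M) / L_m.
Proof.
  intros Hf z0. positive_constants.
  set (p := fun z => exp (2 * z * (mu_M / L_m) - z ^ 2 * (N_m / L_M))).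
  assert (Hp : forall x, continuous p x).
  { intros x. apply (ex_derive_continuous p). unfold p. auto_derive. trivial. }
  rewrite <- (Rminus_0_r (opPhi f z)), <- (opPhi_0 f), opPhi_minus by trivial.
  destruct (RInt_bounds (flux f) (fun _ => 0) (fun z => scal (/ L_m) (p z)) 0 z) as [_ B];
    auto using continuous_const, continuous_flux.
  - intros x. now apply (continuous_scal_r (/ L_m) p).
  - intros x Hx. replace (scal (/ L_m) (p x)) with (p x / L_m)
      by (unfold scal; simpl; unfold mult; simpl; field; lra).
    apply flux_bounds; auto; lra.
  - eapply Rle_trans; [exact B |].
    rewrite (RInt_scal p) by now apply ex_RInt_cont.
    unfold scal; simpl; unfold mult; simpl. rewrite (Rmult_comm (/ L_m)).
    apply Rmult_le_compat_r; [apply Rlt_le, Rinv_0_lt_compat; lra |].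
    apply (RInt_exp_quadratic_le (mu_M / L_m)). now apply Rdiv_lt_0_compat.
Qed.

(** * The boundary coefficient *)

Definition Gmax : R := 2 * Bi + rad * (Tstar ^ 4 - Tm ^ 4).

Lemma temp_bounds (y : R) : 0 <= y <= 1 -> Tm <= temp y <= Tstar.
Proof. intros Hy. unfold temp. destruct Hpos. nra. Qed.

Lemma G0_bounds (f : R -> R) : 0 <= f 0 <= 1 -> 2 * Bi * f 0 <= G0 f <= Gmax.
Proof.
  intros Hf. positive_constants. unfold G0, F0, Gmax.
  pose proof (temp_bounds _ Hf) as HT. fold (temp (f 0)).
  assert (0 < Tm) by apply Hpos.
  assert (temp (f 0) ^ 4 <= Tstar ^ 4) by (apply pow_incr; lra).
  assert (Tm ^ 4 <= temp (f 0) ^ 4) by (apply pow_incr; lra).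
  split; [| apply Rplus_le_compat].
  - assert (0 <= rad * (Tstar ^ 4 - temp (f 0) ^ 4)) by (apply Rmult_le_pos; lra). lra.
  - rewrite <- (Rmult_1_r (2 * Bi)) at 2. apply Rmult_le_compat_l; lra.
  - apply Rmult_le_compat_l; lra.
Qed.

Lemma G0_nonneg (f : R -> R) : 0 <= f 0 <= 1 -> 0 <= G0 f.
Proof.
  intros Hf. positive_constants. pose proof (G0_bounds f Hf).
  assert (0 <= 2 * Bi * f 0) by (apply Rmult_le_pos; lra). lra.
Qed.

Lemma Gmax_pos : 0 < Gmax.
Proof.
  positive_constants.
  assert (Tm ^ 4 <= Tstar ^ 4) by (apply pow_incr; destruct Hpos; lra).
  assert (0 <= rad * (Tstar ^ 4 - Tm ^ 4)) by (apply Rmult_le_pos; lra).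
  unfold Gmax. lra.
Qed.

Lemma Gmax_lt : Gmax < 2 * Bi + rad * Tstar ^ 4.
Proof.
  positive_constants. assert (0 < Tm ^ 4) by (apply pow_lt, Hpos). unfold Gmax. nra.
Qed.

Lemma G0_lipschitz (f g : R -> R) :
  0 <= f 0 <= 1 -> 0 <= g 0 <= 1 ->
  Rabs (G0 f - G0 g) <= (2 * Bi + rad * D5) * Rabs (f 0 - g 0).
Proof.
  intros Hf Hg. positive_constants.
  pose proof (temp_bounds _ Hf). pose proof (temp_bounds _ Hg).
  assert (0 < Tm < Tstar) by (destruct Hpos; lra).
  unfold G0, F0. fold (temp (f 0)) (temp (g 0)).
  replace (2 * Bi * f 0 + rad * (Tstar ^ 4 - temp (f 0) ^ 4)
           - (2 * Bi * g 0 + rad * (Tstar ^ 4 - temp (g 0) ^ 4)))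
    with (2 * Bi * (f 0 - g 0) + rad * (temp (g 0) ^ 4 - temp (f 0) ^ 4)) by ring.
  eapply Rle_trans; [apply Rabs_triang |].
  rewrite !Rabs_mult, (Rabs_pos_eq 2), (Rabs_pos_eq Bi), (Rabs_pos_eq rad) by lra.
  assert (Rabs (temp (g 0) ^ 4 - temp (f 0) ^ 4) <= D5 * Rabs (f 0 - g 0)).
  { eapply Rle_trans; [apply (pow4_diff_le _ _ Tstar); lra |].
    unfold D5. rewrite (Rabs_pos_eq Tstar) by lra.
    replace (temp (g 0) - temp (f 0)) with ((Tstar - Tm) * (f 0 - g 0))
      by (unfold temp; ring).
    rewrite Rabs_mult, (Rabs_pos_eq (Tstar - Tm)) by lra. lra. }
  rewrite Rmult_plus_distr_r, Rmult_assoc.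
  apply Rplus_le_compat; [lra |]. rewrite Rmult_assoc. apply Rmult_le_compat_l; lra.
Qed.

Lemma calE_lt (y z : R) : 0 <= y < z -> calE y < calE z.
Proof.
  intros Hyz. positive_constants.
  destruct (D4_nonneg_incr y z) as [? ?]; [lra |].
  assert (HU : expU y < expU z).
  { apply exp_increasing, Rmult_lt_compat_l; [| lra].
    apply Rmult_lt_0_compat; [lra | now apply Rdiv_lt_0_compat]. }
  pose proof Gmax_pos. pose proof Gmax_lt.
  assert (0 < rad * D5) by now apply Rmult_lt_0_compat.
  unfold calE. fold (expU y) (expU z).
  apply Rplus_le_lt_compat.
  - apply Rmult_le_compat; try lra; try apply Rmult_le_pos; try lra.
    apply Rmult_le_compat_l; lra.
  - apply Rmult_lt_compat_r; [apply Rdiv_lt_0_compat; lra | trivial].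
Qed.

Lemma calE_le (y z : R) : 0 <= y <= z -> calE y <= calE z.
Proof.
  intros [y0 [yz | ->]]; [| apply Rle_refl]. apply Rlt_le, calE_lt; lra.
Qed.

Lemma calE_nonneg (z : R) : 0 <= z -> 0 <= calE z.
Proof.
  intros z0. positive_constants.
  destruct (D4_nonneg_incr z z) as [? _]; [lra |].
  pose proof Gmax_pos. pose proof Gmax_lt.
  assert (0 < rad * D5) by now apply Rmult_lt_0_compat.
  apply Rplus_le_le_0_compat.
  - repeat first [lra | apply Rmult_le_pos].
  - apply Rmult_le_pos; [apply Rlt_le, exp_pos | apply Rlt_le, Rdiv_lt_0_compat; lra].
Qed.

Lemma is_lambda_bar_exists (lam : R) :
  0 < lam -> calE lam < 1 -> exists lbar, is_lambda_bar lbar /\ lam < lbar.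
Proof.
  intros lam0 Hlam. positive_constants.
  set (A := (2 * Bi + rad * D5) / mu_M). set (c := 2 * (mu_M / L_m)).
  assert (0 < rad * D5) by now apply Rmult_lt_0_compat.
  assert (A0 : 0 < A) by (apply Rdiv_lt_0_compat; lra).
  assert (c0' : 0 < c) by (apply Rmult_lt_0_compat; [lra | now apply Rdiv_lt_0_compat]).
  set (Z := / (A * c)).
  assert (Z0 : 0 < Z) by (apply Rinv_0_lt_compat; now apply Rmult_lt_0_compat).
  assert (HZ : 1 < calE Z).
  { destruct (D4_nonneg_incr Z Z) as [? _]; [lra |].
    pose proof Gmax_pos. pose proof Gmax_lt.
    assert (0 <= 2 * (2 * Bi + rad * Tstar ^ 4) * Z * D4 Z)
      by (repeat first [lra | apply Rmult_le_pos]).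
    pose proof (exp_ineq1_le (c * Z)) as Hexp.
    apply (Rmult_le_compat_r A) in Hexp; [| lra].
    replace ((1 + c * Z) * A) with (A + 1) in Hexp by (unfold Z; field; lra).
    unfold calE. fold A c. lra. }
  assert (lamZ : lam < Z).
  { destruct (Rlt_or_le lam Z) as [| Zlam]; [trivial |].
    pose proof (calE_le Z lam ltac:(lra)). lra. }
  destruct (IVT (fun z => calE z - 1) lam Z) as (lbar & Hl & El); try lra.
  - intros z. apply continuity_pt_filterlim, (ex_derive_continuous (fun z => calE z - 1)).
    unfold calE, D4, D3, D1, D2. auto_derive. repeat split.
  - exists lbar. assert (lam <> lbar) by (intros <-; lra). split; [| lra].
    split; [lra |]. intros z [z0 Hz].
    destruct (Rtotal_order lbar z) as [E | [E | E]]; trivial;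
      [pose proof (calE_lt lbar z) | pose proof (calE_lt z lbar)]; lra.
Qed.

Context (Hsmall : (2 * Bi + rad * (Tstar ^ 4 - Tm ^ 4)) * sqrt (k0 * rho0 * c0 * k_M)
             / (k_m * sqrt gamma_m) * sqrt PI
             * exp (nu_M ^ 2 * k_M / (k_m ^ 2 * gamma_m)) < 1).

Lemma Gmax_opPhi_lt (f : R -> R) (z : R) :
  (forall x, continuous f x) -> 0 <= z -> Gmax * opPhi f z < 1.
Proof.
  intros Hf z0. eapply Rle_lt_trans; [| exact Hsmall].
  eapply Rle_trans.
  { apply Rmult_le_compat_l; [apply Rlt_le, Gmax_pos | now apply opPhi_le_gauss]. }
  right. fold Gmax. destruct Hpos.
  assert (0 < rho0 * c0) by nra.
  assert (r0 : 0 < rho0 * c0 * k0) by nra.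
  assert (w0 : 0 < k0 * rho0 * c0 * k_M)
    by (replace (k0 * rho0 * c0 * k_M) with (rho0 * c0 * k0 * k_M) by ring; nra).
  pose proof (sqrt_sqrt _ (Rlt_le _ _ w0)) as Ew. apply sqrt_lt_R0 in w0.
  set (w := sqrt (k0 * rho0 * c0 * k_M)) in *.
  pose proof (sqrt_sqrt _ (Rlt_le _ _ gamma_m_pos)) as Eg.
  pose proof (sqrt_lt_R0 _ gamma_m_pos) as g0. set (sg := sqrt gamma_m) in *.
  assert (En : sqrt (N_m / L_M) = sg * k0 / w).
  { replace (N_m / L_M) with (Rsqr (sg * k0 / w)).
    - apply sqrt_Rsqr, Rlt_le, Rdiv_lt_0_compat; nra.
    - unfold Rsqr. replace (sg * k0 / w * (sg * k0 / w))
        with ((sg * sg) * (k0 * k0) / (w * w)) by (field; lra).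
      rewrite Eg, Ew. unfold N_m, L_M. field. lra. }
  rewrite En.
  replace ((mu_M / L_m) ^ 2 / (N_m / L_M)) with (nu_M ^ 2 * k_M / (k_m ^ 2 * gamma_m)).
  - unfold L_m. field. lra.
  - pose proof (sqrt_sqrt _ (Rlt_le _ _ r0)) as Er. apply sqrt_lt_R0 in r0.
    unfold mu_M, L_m, N_m, L_M.
    set (sr := sqrt (rho0 * c0 * k0)) in *.
    replace ((nu_M / sr / (k_m / k0)) ^ 2 / (gamma_m / (rho0 * c0) / (k_M / k0)))
      with (nu_M ^ 2 * k_M * (rho0 * c0 * k0) / (k_m ^ 2 * gamma_m * (sr * sr)))
      by (field; lra).
    rewrite Er. field. lra.
Qed.

(** * The fixed point operator *)

Definition Psi (lam : R) (f : R -> R) (x : R) : R :=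
  1 - G0 f * (opPhi f lam - opPhi f (clamp lam x)).

Context (lam2 : R) (Hlam2 : 0 < lam2) (HE : calE lam2 < 1).

Definition lipK : R := Gmax * (expU lam2 / L_m).

Lemma lipK_pos : 0 < lipK.
Proof.
  positive_constants. apply Rmult_lt_0_compat; [apply Gmax_pos |].
  apply Rdiv_lt_0_compat; [apply exp_pos | trivial].
Qed.

Lemma unit_lipschitz_continuous (K : R) (f : R -> R) :
  unit_lipschitz K f -> forall x, continuous f x.
Proof. intros [_ H] x. apply (continuous_at_of_le _ K). intros a. apply H. Qed.

Lemma G0_abs_le (f : R -> R) : 0 <= f 0 <= 1 -> Rabs (G0 f) <= Gmax.
Proof. intros Hf. rewrite Rabs_pos_eq; [apply G0_bounds | apply G0_nonneg]; trivial. Qed.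

Lemma Psi_unit (lam : R) (f : R -> R) (x : R) :
  0 <= lam -> (forall x, continuous f x) -> 0 <= f 0 <= 1 -> 0 <= Psi lam f x <= 1.
Proof.
  intros lam0 Hf H0. positive_constants. unfold Psi.
  pose proof (clamp_segment lam x lam0) as Hc.
  pose proof (opPhi_increment f _ _ lam Hf Hc (Rle_refl _)) as [A _].
  pose proof (opPhi_increment f 0 (clamp lam x) lam Hf ltac:(lra) ltac:(lra)) as [B _].
  rewrite opPhi_0 in B. pose proof (Gmax_opPhi_lt f lam Hf lam0).
  pose proof (G0_nonneg f H0). pose proof (G0_bounds f H0).
  assert (0 <= G0 f * (opPhi f lam - opPhi f (clamp lam x))) by (apply Rmult_le_pos; lra).
  assert (G0 f * (opPhi f lam - opPhi f (clamp lam x)) <= Gmax * opPhi f lam)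
    by (apply Rmult_le_compat; lra).
  lra.
Qed.

Lemma Psi_lipschitz (lam : R) (f : R -> R) (x y : R) :
  0 <= lam <= lam2 -> (forall x, continuous f x) -> 0 <= f 0 <= 1 ->
  Rabs (Psi lam f x - Psi lam f y) <= lipK * Rabs (x - y).
Proof.
  intros Hlam Hf H0. positive_constants. unfold Psi, lipK.
  replace (1 - G0 f * (opPhi f lam - opPhi f (clamp lam x))
           - (1 - G0 f * (opPhi f lam - opPhi f (clamp lam y))))
    with (G0 f * (opPhi f (clamp lam x) - opPhi f (clamp lam y))) by ring.
  rewrite Rabs_mult, Rmult_assoc.
  apply Rmult_le_compat; try apply Rabs_pos; [now apply G0_abs_le |].
  pose proof (clamp_segment lam x). pose proof (clamp_segment lam y).
  eapply Rle_trans; [apply (opPhi_lipschitz f _ _ lam2); auto; lra |].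
  apply Rmult_le_compat_l; [| apply clamp_lipschitz; lra].
  apply Rlt_le, Rdiv_lt_0_compat; [apply exp_pos | trivial].
Qed.

Lemma Psi_unit_lipschitz (lam : R) (f : R -> R) :
  0 <= lam <= lam2 -> unit_lipschitz lipK f -> unit_lipschitz lipK (Psi lam f).
Proof.
  intros Hlam Hf. pose proof (unit_lipschitz_continuous _ _ Hf). destruct Hf as [Hf _].
  split; intros; [apply Psi_unit | apply Psi_lipschitz]; auto; lra.
Qed.

Lemma Psi_contraction (lam : R) (f g : R -> R) (delta x : R) :
  0 <= lam <= lam2 -> (forall x, continuous f x) -> (forall x, continuous g x) ->
  0 <= f 0 <= 1 -> 0 <= g 0 <= 1 -> 0 <= delta ->
  (forall x, Rabs (f x - g x) <= delta) ->
  Rabs (Psi lam f x - Psi lam g x) <= calE lam2 * delta.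
Proof.
  intros Hlam Hf Hg Hf0 Hg0 Hdelta H. positive_constants.
  apply Rle_trans with (calE lam * delta).
  2: { apply Rmult_le_compat_r; [trivial |]. now apply calE_le. }
  set (c := clamp lam x). assert (Hc : 0 <= c <= lam) by (apply clamp_segment; lra).
  unfold Psi. fold c.
  replace (1 - G0 f * (opPhi f lam - opPhi f c) - (1 - G0 g * (opPhi g lam - opPhi g c)))
    with (G0 g * ((opPhi g lam - opPhi g c) - (opPhi f lam - opPhi f c))
          + (G0 g - G0 f) * (opPhi f lam - opPhi f c)) by ring.
  eapply Rle_trans; [apply Rabs_triang |]. rewrite !Rabs_mult.
  destruct (D4_nonneg_incr lam lam) as [D40 _]; [lra |].
  pose proof Gmax_pos. pose proof Gmax_lt.
  assert (0 < rad * D5) by now apply Rmult_lt_0_compat.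
  apply Rle_trans with
    ((2 * Bi + rad * Tstar ^ 4) * (lam * (D4 lam * delta))
     + (2 * Bi + rad * D5) * delta * (expU lam / mu_M)).
  - apply Rplus_le_compat; apply Rmult_le_compat; try apply Rabs_pos.
    + pose proof (G0_abs_le g Hg0). lra.
    + rewrite !opPhi_minus by trivial.
      apply Rle_trans with ((lam - c) * (D4 lam * delta)).
      * apply RInt_diff_le; auto using continuous_flux; try lra.
        intros y Hy. eapply Rle_trans.
        { apply flux_lipschitz with (delta := delta); auto; [lra |].
          intros u. rewrite Rabs_minus_sym. apply H. }
        apply Rmult_le_compat_r; [trivial |]. apply D4_nonneg_incr; lra.
      * apply Rmult_le_compat_r; [| lra]. now apply Rmult_le_pos.
    + rewrite Rabs_minus_sym. eapply Rle_trans; [now apply G0_lipschitz |].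
      apply Rmult_le_compat_l; [lra | apply H].
    + pose proof (opPhi_increment f c lam lam Hf ltac:(lra) ltac:(lra)) as [A _].
      pose proof (opPhi_increment f 0 c lam Hf ltac:(lra) ltac:(lra)) as [B _].
      rewrite opPhi_0 in B.
      rewrite Rabs_pos_eq by trivial.
      pose proof (opPhi_le_expU f lam Hf ltac:(lra)). lra.
  - unfold calE. fold (expU lam).
    assert (0 <= (2 * Bi + rad * Tstar ^ 4) * (lam * (D4 lam * delta))).
    { repeat first [lra | apply Rmult_le_pos]. }
    replace ((2 * Bi + rad * D5) * delta * (expU lam / mu_M))
      with (expU lam * ((2 * Bi + rad * D5) / mu_M) * delta) by (field; lra).
    lra.
Qed.

Lemma Psi_lipschitz_param (l1 l2 : R) (f : R -> R) (x : R) :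
  0 <= l1 <= lam2 -> 0 <= l2 <= lam2 -> (forall x, continuous f x) -> 0 <= f 0 <= 1 ->
  Rabs (Psi l1 f x - Psi l2 f x) <= 2 * lipK * Rabs (l1 - l2).
Proof.
  intros H1 H2 Hf H0. positive_constants. unfold Psi, lipK.
  replace (1 - G0 f * (opPhi f l1 - opPhi f (clamp l1 x))
           - (1 - G0 f * (opPhi f l2 - opPhi f (clamp l2 x))))
    with (G0 f * ((opPhi f (clamp l1 x) - opPhi f (clamp l2 x))
                  + - (opPhi f l1 - opPhi f l2))) by ring.
  replace (2 * (Gmax * (expU lam2 / L_m)) * Rabs (l1 - l2))
    with (Gmax * (expU lam2 / L_m * Rabs (l1 - l2) + expU lam2 / L_m * Rabs (l1 - l2)))
    by ring.
  rewrite Rabs_mult.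
  apply Rmult_le_compat; try apply Rabs_pos; [now apply G0_abs_le |].
  eapply Rle_trans; [apply Rabs_triang |]. rewrite Rabs_Ropp.
  pose proof (clamp_segment l1 x). pose proof (clamp_segment l2 x).
  apply Rplus_le_compat; [| now apply opPhi_lipschitz].
  eapply Rle_trans; [apply (opPhi_lipschitz f _ _ lam2); auto; lra |].
  apply Rmult_le_compat_l; [| apply clamp_lipschitz_bound; lra].
  apply Rlt_le, Rdiv_lt_0_compat; [apply exp_pos | trivial].
Qed.

Lemma contraction_factor : 0 <= calE lam2 < 1.
Proof. split; [apply calE_nonneg; lra | exact HE]. Qed.

Lemma Psi_fixed_points_close (l1 l2 : R) (f g : R -> R) :
  0 <= l1 <= lam2 -> 0 <= l2 <= lam2 ->
  (forall x, continuous f x) -> (forall x, continuous g x) ->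
  (forall x, 0 <= f x <= 1) -> (forall x, 0 <= g x <= 1) ->
  (forall x, Psi l1 f x = f x) -> (forall x, Psi l2 g x = g x) ->
  forall x, Rabs (f x - g x) <= 2 * lipK * Rabs (l1 - l2) / (1 - calE lam2).
Proof.
  intros H1 H2 Hf Hg Uf Ug Ff Fg. pose proof lipK_pos.
  apply geometric_bound; [apply contraction_factor | | |].
  - apply Rmult_le_pos; [lra | apply Rabs_pos].
  - intros x. specialize (Uf x). specialize (Ug x). apply Rabs_le. lra.
  - intros delta Hdelta Hd x. rewrite <- Ff, <- Fg.
    replace (Psi l1 f x - Psi l2 g x)
      with ((Psi l1 f x - Psi l2 f x) + (Psi l2 f x - Psi l2 g x)) by ring.
    eapply Rle_trans; [apply Rabs_triang |]. apply Rplus_le_compat.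
    + now apply Psi_lipschitz_param.
    + now apply Psi_contraction.
Qed.

Lemma Psi_fixed_point_family :
  {F : R -> R -> R | forall lam, 0 <= lam <= lam2 ->
     unit_lipschitz lipK (F lam) /\ forall x, Psi lam (F lam) x = F lam x}.
Proof.
  assert (H : forall lam, 0 <= clamp lam2 lam <= lam2) by (intros; apply clamp_segment; lra).
  assert (S : forall lam, {f | unit_lipschitz lipK f /\ forall x, Psi (clamp lam2 lam) f x = f x}).
  { intros lam. apply lipschitz_contraction_fixed_point with (q := calE lam2).
    - apply Rlt_le, lipK_pos.
    - apply contraction_factor.
    - intros f. now apply Psi_unit_lipschitz.
    - intros f g delta Hf Hg Hdelta Hd x.
      pose proof (unit_lipschitz_continuous _ _ Hf).
      pose proof (unit_lipschitz_continuous _ _ Hg).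
      destruct Hf, Hg. now apply Psi_contraction. }
  exists (fun lam => proj1_sig (S lam)). intros lam Hlam.
  destruct (S lam) as (f & Hf & Ff); simpl. rewrite clamp_id in Ff by trivial. now split.
Qed.

Lemma fixed_point_root :
  calV2 lam2 = lam2 ->
  exists (lam : R) (f : R -> R), 0 < lam < lam2 /\ unit_lipschitz lipK f /\
    (forall x, Psi lam f x = f x) /\ Ste * G0 f / 2 * opE f lam = lam.
Proof.
  intros HV2. positive_constants. pose proof lipK_pos. pose proof contraction_factor.
  pose proof Gmax_pos.
  destruct Psi_fixed_point_family as [F HF].
  set (c := clamp lam2).
  assert (Hc : forall a, 0 <= c a <= lam2) by (intros; apply clamp_segment; lra).
  set (phi := fun a => F (c a)).
  assert (Hphi : forall a x, continuous (phi a) x).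
  { intros a. apply (unit_lipschitz_continuous lipK), HF, Hc. }
  assert (Uphi : forall a x, 0 <= phi a x <= 1) by (intros a; apply HF, Hc).
  set (C := 2 * lipK / (1 - calE lam2)).
  assert (HC : forall a b x, Rabs (phi a x - phi b x) <= C * Rabs (a - b)).
  { intros a b x. unfold C.
    replace (2 * lipK / (1 - calE lam2) * Rabs (a - b))
      with (2 * lipK * Rabs (a - b) / (1 - calE lam2)) by (field; lra).
    destruct (HF (c a) (Hc a)), (HF (c b) (Hc b)).
    eapply Rle_trans; [apply (Psi_fixed_points_close (c a) (c b)); auto; apply Hphi |].
    apply Rmult_le_compat_r; [apply Rlt_le, Rinv_0_lt_compat; lra |].
    apply Rmult_le_compat_l; [lra |]. apply clamp_lipschitz; lra. }
  assert (C0 : 0 <= C) by (apply Rlt_le, Rdiv_lt_0_compat; lra).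
  set (V := fun a => Ste * G0 (phi a) / 2 * opE (phi a) (c a)).
  assert (cG : forall b, continuous (fun a => G0 (phi a)) b).
  { intros b. apply (continuous_at_of_le _ ((2 * Bi + rad * D5) * C)). intros a.
    eapply Rle_trans; [now apply G0_lipschitz |].
    rewrite Rmult_assoc. apply Rmult_le_compat_l; [| apply HC].
    assert (0 < rad * D5) by now apply Rmult_lt_0_compat. lra. }
  assert (cE : forall b, continuous (fun a => opE (phi a) (c a)) b).
  { intros b.
    apply (continuous_ext
      (fun a => plus (opE (phi a) (c a) - opE (phi b) (c a)) (opE (phi b) (c a)))).
    { intros a. unfold plus; simpl. ring. }
    apply (continuous_plus (fun a => opE (phi a) (c a) - opE (phi b) (c a))
             (fun a => opE (phi b) (c a))).
    - apply (continuous_at_of_le _ (D3 lam2 * C)). intros a.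
      rewrite (Rminus_diag (opE (phi b) (c b))), Rminus_0_r.
      eapply Rle_trans; [apply opE_lipschitz; auto; apply Hc |].
      rewrite Rmult_assoc. apply Rmult_le_compat_r.
      + apply Rmult_le_pos; [trivial | apply Rabs_pos].
      + apply D3_nonneg_incr, Hc.
    - apply (continuous_comp c (opE (phi b))); [apply continuous_clamp; lra |].
      now apply continuous_opE. }
  assert (cV : continuity (fun a => c a - V a)).
  { intros b. apply continuity_pt_filterlim.
    apply (continuous_minus c V); [apply continuous_clamp; lra |].
    apply (continuous_mult (fun a => Ste * G0 (phi a) / 2)); [| apply cE].
    apply (continuous_mult (fun a => Ste * G0 (phi a)) (fun _ => / 2));
      [| apply continuous_const].
    apply (continuous_mult (fun _ => Ste)); [apply continuous_const | apply cG]. }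
  assert (V0 : c 0 - V 0 < 0).
  { assert (c0' : c 0 = 0) by (apply clamp_id; lra). rewrite c0'.
    assert (P0 : phi 0 0 = 1).
    { destruct (HF (c 0) (Hc 0)) as [_ E]. unfold phi. rewrite <- E. unfold Psi.
      rewrite !c0', clamp_id by lra. ring. }
    pose proof (G0_bounds (phi 0) (Uphi 0 0)) as [A _]. rewrite P0 in A.
    pose proof (opE_pos (phi 0) (c 0)).
    assert (0 < V 0); [| lra]. unfold V. apply Rmult_lt_0_compat; [| trivial].
    apply Rdiv_lt_0_compat; [apply Rmult_lt_0_compat |]; lra. }
  assert (V2 : 0 < c lam2 - V lam2).
  { assert (cl : c lam2 = lam2) by (apply clamp_id; lra). unfold V. rewrite cl.
    rewrite <- HV2 at 1. unfold calV2.
    pose proof (opE_le (phi lam2) lam2 (Hphi lam2) (Rlt_le _ _ Hlam2)) as A.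
    set (e := exp (2 * lam2 * (mu_M / L_m) - lam2 ^ 2 * (N_m / L_M))) in *.
    pose proof (opE_pos (phi lam2) lam2).
    pose proof (G0_bounds (phi lam2) (Uphi lam2 0)) as [_ B]. pose proof Gmax_lt.
    pose proof (G0_nonneg (phi lam2) (Uphi lam2 0)).
    apply Rlt_0_minus.
    apply Rle_lt_trans with (Ste * Gmax / 2 * e).
    - apply Rmult_le_compat; try lra.
      + apply Rmult_le_pos; [apply Rmult_le_pos; lra | lra].
      + apply Rmult_le_compat_r; [lra |]. apply Rmult_le_compat_l; lra.
    - apply Rmult_lt_compat_r; [lra |]. apply Rmult_lt_compat_r; [lra |].
      apply Rmult_lt_compat_l; lra. }
  destruct (IVT _ 0 lam2 cV Hlam2 V0 V2) as (lam & Hl & El). cbv beta in El.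
  assert (lam <> 0) by (intros E; rewrite E in El; lra).
  assert (lam <> lam2) by (intros E; rewrite E in El; lra).
  assert (cl : c lam = lam) by (apply clamp_id; lra).
  exists lam, (phi lam). split; [lra |].
  destruct (HF (c lam) (Hc lam)) as [Uf Ff].
  split; [exact Uf |]. split; [intros x; rewrite <- cl at 1; apply Ff |].
  unfold V in El. rewrite cl in El. lra.
Qed.

Lemma opE_ext (f g : R -> R) (z : R) :
  0 <= z -> (forall x, 0 <= x <= z -> f x = g x) -> opE f z = opE g z.
Proof.
  intros z0 H. unfold opE, opU, opI.
  f_equal; do 2 f_equal; apply RInt_ext; rewrite Rmin_left, Rmax_right by trivial;
    intros x Hx; unfold mustar, Nstar, Lstar; now rewrite H by lra.
Qed.

Lemma opPhi_ext (f g : R -> R) (z : R) :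
  0 <= z -> (forall x, 0 <= x <= z -> f x = g x) -> opPhi f z = opPhi g z.
Proof.
  intros z0 H. apply RInt_ext. rewrite Rmin_left, Rmax_right by trivial.
  intros x Hx. rewrite (opE_ext f g x); [| lra | intros; apply H; lra].
  unfold Lstar. now rewrite H by lra.
Qed.

Lemma fixed_point_Psi (lam : R) (g : R -> R) (x : R) :
  0 <= lam -> fixed_point lam g ->
  Psi lam (fun y => g (clamp lam y)) x = g (clamp lam x).
Proof.
  intros lam0 Hg. pose proof (clamp_segment lam x lam0) as Hc.
  assert (H : forall y, 0 <= y <= lam -> g (clamp lam y) = g y)
    by (intros y Hy; now rewrite clamp_id).
  rewrite (Hg _ Hc). unfold Psi, G0, F0.
  rewrite H by lra. rewrite (opPhi_ext _ g lam); auto.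
  rewrite (opPhi_ext _ g (clamp lam x)); [trivial | lra |]. intros; apply H; lra.
Qed.

Lemma Psi_is_f_lambda (lam : R) (f : R -> R) :
  0 <= lam <= lam2 -> (forall x, continuous f x) -> (forall x, 0 <= f x <= 1) ->
  (forall x, Psi lam f x = f x) -> is_f_lambda lam f.
Proof.
  intros Hlam Hf Uf Ff. split; [| split].
  - split; [| split].
    + apply continuous_on_forall. auto.
    + intros x _. apply Uf.
    + apply supnorm_le. intros x _. specialize (Uf x). apply Rabs_le. lra.
  - intros x Hx. rewrite <- Ff at 1. unfold Psi. now rewrite clamp_id.
  - intros g (Cg & g0 & g1) Fg x Hx.
    assert (Ug : forall y, 0 <= g (clamp lam y) <= 1).
    { intros y. pose proof (clamp_segment lam y ltac:(lra)) as Hc.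
      split; [now apply g0 |].
      pose proof (proj1 (supnorm_le _ _ _) g1 _ Hc). pose proof (Rle_abs (g (clamp lam y))).
      lra. }
    pose proof (Psi_fixed_points_close lam lam (fun y => g (clamp lam y)) f Hlam Hlam
      (fun y => continuous_comp_clamp lam g y ltac:(lra) Cg) Hf Ug Uf
      (fun y => fixed_point_Psi lam g y ltac:(lra) Fg) Ff x) as H.
    cbv beta in H. rewrite clamp_id, Rminus_diag, Rabs_R0 in H by trivial.
    unfold Rdiv in H. rewrite Rmult_0_r, Rmult_0_l in H.
    pose proof (Rabs_pos (g x - f x)).
    destruct (Req_dec (g x - f x) 0) as [E | E]; [lra |].
    apply Rabs_pos_lt in E. lra.
Qed.

(** * The similarity solution *)

Definition profile (lam : R) (f : R -> R) (xi : R) : R :=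
  1 - G0 f * (opPhi f lam - opPhi f xi).

Definition similarity (x t : R) : R := x / (2 * sqrt (alpha0 * t)).

Lemma is_derive_profile (lam : R) (f : R -> R) (xi : R) :
  (forall x, continuous f x) -> is_derive (profile lam f) xi (G0 f * flux f xi).
Proof.
  intros Hf. unfold profile. evar_last.
  - apply (is_derive_minus (fun _ => 1) (fun xi => G0 f * (opPhi f lam - opPhi f xi))).
    + apply (is_derive_const (K := R_AbsRing) (V := R_NormedModule)).
    + apply is_derive_scal.
      apply (is_derive_minus (fun _ => opPhi f lam) (opPhi f)).
      * apply (is_derive_const (K := R_AbsRing) (V := R_NormedModule)).
      * now apply is_derive_opPhi.
  - unfold minus, plus, opp, zero; simpl. ring.
Qed.

Lemma is_derive_temp_profile (lam : R) (f : R -> R) (u : R -> R) (x du : R) :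
  (forall x, continuous f x) -> is_derive u x du ->
  is_derive (fun y => temp (profile lam f (u y))) x
    ((Tm - Tstar) * (G0 f * flux f (u x)) * du).
Proof.
  intros Hf Hu. unfold temp. evar_last.
  - apply (is_derive_plus (fun y => (Tm - Tstar) * profile lam f (u y)) (fun _ => Tstar)).
    + apply is_derive_scal, (is_derive_comp (profile lam f)); [| exact Hu].
      now apply is_derive_profile.
    + apply (is_derive_const (K := R_AbsRing) (V := R_NormedModule)).
  - unfold plus, zero, scal; simpl; unfold mult; simpl. ring.
Qed.

Lemma stefan_solution_of_fixed_point (lam : R) (f : R -> R) :
  0 < lam -> (forall x, continuous f x) -> (forall x, Psi lam f x = f x) ->
  Ste * G0 f / 2 * opE f lam = lam ->
  stefan_solution (fun x t => temp (profile lam f (similarity x t)))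
    (fun t => 2 * lam * sqrt (alpha0 * t)).
Proof.
  intros lam0 Hf Ff Hlam. positive_constants.
  assert (Hfp : forall xi, 0 <= xi <= lam -> profile lam f xi = f xi).
  { intros xi Hxi. rewrite <- Ff. unfold Psi, profile. now rewrite clamp_id. }
  assert (Hr : forall t, 0 < t -> 0 < sqrt (alpha0 * t))
    by (intros; apply sqrt_lt_R0; now apply Rmult_lt_0_compat).
  assert (Hxi : forall x t, 0 < t -> 0 <= x <= 2 * lam * sqrt (alpha0 * t) ->
            0 <= similarity x t <= lam).
  { intros x t t0 Hx. specialize (Hr t t0). unfold similarity. split.
    - apply Rcomplements.Rdiv_le_0_compat; lra.
    - apply Rle_div_l; lra. }
  assert (Dsx : forall x t, 0 < t ->
            is_derive (fun y => similarity y t) x (/ (2 * sqrt (alpha0 * t)))).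
  { intros x t t0. specialize (Hr t t0). unfold similarity. auto_derive; [trivial |].
    field; lra. }
  assert (Dst : forall x t, 0 < t ->
            is_derive (fun tau => similarity x tau) t (- similarity x t / (2 * t))).
  { intros x t t0. specialize (Hr t t0). unfold similarity.
    assert (at0 : 0 < alpha0 * t) by now apply Rmult_lt_0_compat.
    auto_derive; [repeat split; lra |].
    pose proof (sqrt_sqrt _ (Rlt_le _ _ at0)) as E.
    set (r := sqrt (alpha0 * t)) in *.
    replace alpha0 with (r * r / t) by (rewrite E; field; lra). field. lra. }
  split; [rewrite Rmult_0_r, sqrt_0; ring |].
  split.
  { apply continuous_on_forall. intros t _.
    apply (continuous_comp (fun t => sqrt (alpha0 * t)) (fun r => 2 * lam * r));
      [| apply continuous_linear].
    apply (continuous_comp (fun t => alpha0 * t) sqrt);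
      [apply continuous_linear | apply continuous_sqrt]. }
  split.
  { intros t t0. specialize (Hr t t0). apply Rmult_lt_0_compat; lra. }
  split.
  { apply continuous_on_forall. intros [x t] [t0 _]; simpl in t0.
    apply (continuous_comp (fun p : R * R => similarity (fst p) (snd p))
             (fun xi => temp (profile lam f xi))).
    - apply (continuous_mult (fst : R * R -> R) (fun p => / (2 * sqrt (alpha0 * snd p)))).
      + apply continuous_fst.
      + apply (continuous_comp (fun p : R * R => snd p) (fun t => / (2 * sqrt (alpha0 * t)))).
        * apply continuous_snd.
        * apply (ex_derive_continuous (fun t => / (2 * sqrt (alpha0 * t)))).
          specialize (Hr t t0). assert (0 < alpha0 * t) by now apply Rmult_lt_0_compat.
          auto_derive. simpl. repeat split; lra.
    - apply (ex_derive_continuous (fun xi => temp (profile lam f xi))).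
      eexists. apply (is_derive_temp_profile lam f (fun xi => xi)); [trivial |].
      apply (is_derive_id (K := R_AbsRing)). }
  set (A := (Tm - Tstar) * G0 f).
  exists (fun x t => A * flux f (similarity x t) / (2 * sqrt (alpha0 * t))),
    (fun x t => A * flux f (similarity x t) * (- similarity x t / (2 * t))),
    (fun x t => k0 * A / (2 * sqrt (alpha0 * t)) *
       (opE f (similarity x t) *
         (2 * (mustar f (similarity x t) / Lstar f (similarity x t))
          - 2 * (similarity x t * Nstar f (similarity x t) / Lstar f (similarity x t)))
        / (2 * sqrt (alpha0 * t)))),
    (fun t => lam * alpha0 / sqrt (alpha0 * t)).
  assert (Hk : forall xi, 0 <= xi <= lam ->
            coef_k (temp (profile lam f xi)) = k0 * Lstar f xi).
  { intros xi Hx. rewrite Hfp by trivial. unfold Lstar. destruct Hpos. field. lra. }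
  assert (Hq : forall x t, 0 < t -> 0 <= x <= 2 * lam * sqrt (alpha0 * t) ->
            coef_k (temp (profile lam f (similarity x t)))
              * (A * flux f (similarity x t) / (2 * sqrt (alpha0 * t)))
            = k0 * A / (2 * sqrt (alpha0 * t)) * opE f (similarity x t)).
  { intros x t t0 Hx. rewrite Hk by auto. specialize (Hr t t0). unfold flux.
    pose proof (Lstar_pos f (similarity x t)). field. lra. }
  assert (Hsqrt : forall t, 0 < t -> sqrt (alpha0 * t) = sqrt alpha0 * sqrt t)
    by (intros; apply sqrt_mult; lra).
  assert (p0 : 0 < sqrt alpha0) by now apply sqrt_lt_R0.
  assert (Ep : sqrt alpha0 * sqrt alpha0 = alpha0) by (apply sqrt_sqrt; lra).
  pose proof Hpos as Hp. destruct Hp.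
  assert (Hs0 : forall t, 0 < t -> similarity 0 t = 0)
    by (intros; unfold similarity, Rdiv; ring).
  assert (Hsl : forall t, 0 < t -> similarity (2 * lam * sqrt (alpha0 * t)) t = lam).
  { intros t t0. specialize (Hr t t0). unfold similarity. field. lra. }
  assert (Hrange : forall t, 0 < t -> 0 <= 2 * lam * sqrt (alpha0 * t)).
  { intros t t0. specialize (Hr t t0). apply Rmult_le_pos; lra. }
  split; [| split; [| split; [| split; [| split]]]].
  - intros t t0. specialize (Hr t t0). assert (0 < alpha0 * t) by now apply Rmult_lt_0_compat.
    auto_derive; [lra |]. field. lra.
  - intros x t t0 _. apply is_derive_derive_within. evar_last.
    + apply (is_derive_temp_profile lam f (fun y => similarity y t)); auto.
    + unfold A, Rdiv. ring.
  - intros x t t0 Hx. split; [| split].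
    + evar_last.
      * apply (is_derive_temp_profile lam f (fun tau => similarity x tau)); auto.
      * unfold A. ring.
    + apply is_derive_ext_loc with
        (f := fun y => k0 * A / (2 * sqrt (alpha0 * t)) * opE f (similarity y t)).
      * pose proof (open_and _ _ (open_gt 0) (open_lt (2 * lam * sqrt (alpha0 * t)))) as Ho.
        generalize (Ho x Hx). apply filter_imp. intros y Hy. symmetry.
        apply Hq; [trivial | lra].
      * apply is_derive_scal. evar_last.
        -- apply (is_derive_comp (opE f) (fun y => similarity y t)); [| auto].
           now apply is_derive_opE.
        -- unfold scal; simpl; unfold mult; simpl. unfold Rdiv. ring.
    + assert (Hx' : 0 <= similarity x t <= lam) by (apply Hxi; [trivial | lra]).
      pose proof sqrt_data_pos as sr0.
      assert (Hsr : sqrt (rho0 * c0 * k0) = k0 / sqrt alpha0).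
      { apply Rmult_eq_reg_r with (sqrt alpha0); [| lra].
        rewrite <- sqrt_mult; [| left; apply Rmult_lt_0_compat; [nra | lra] | lra].
        replace (rho0 * c0 * k0 * alpha0) with (Rsqr k0)
          by (unfold Rsqr, alpha0; field; lra).
        rewrite sqrt_Rsqr by lra. field. lra. }
      assert (HN : coef_rho (temp (profile lam f (similarity x t)))
                   * coef_c (temp (profile lam f (similarity x t)))
                   = k0 / (sqrt alpha0 * sqrt alpha0) * Nstar f (similarity x t)).
      { rewrite Ep, Hfp by trivial. unfold Nstar, alpha0. field. lra. }
      assert (Hmu : coef_mu (temp (profile lam f (similarity x t)))
                    = k0 / sqrt alpha0 * mustar f (similarity x t)).
      { rewrite <- Hsr, Hfp by trivial. unfold mustar. field. lra. }
      rewrite HN, Hmu. unfold flux.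
      generalize (similarity x t). intros xi. pose proof (Lstar_pos f xi).
      rewrite Hsqrt by trivial.
      pose proof (sqrt_lt_R0 t t0) as w0. pose proof (sqrt_sqrt t ltac:(lra)) as Ew.
      generalize dependent (sqrt t). intros w w0 Ew. rewrite <- Ew.
      field. lra.
  - intros t t0. rewrite Hq; [| trivial | split; [lra | auto]]. rewrite Hs0 by trivial.
    rewrite Hfp by lra.
    replace (opE f 0) with 1.
    2: { unfold opE, opU, opI. rewrite !RInt_point. unfold zero; simpl.
         rewrite Rmult_0_r, exp_0. field. }
    rewrite Hsqrt by trivial. pose proof (sqrt_lt_R0 t t0).
    unfold A, G0, F0, Bi, rad. fold (temp (f 0)).
    replace (temp (f 0) - Tstar) with ((Tm - Tstar) * f 0) by (unfold temp; ring).
    field. lra.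
  - intros t t0. rewrite Hsl by trivial. unfold profile, temp. ring.
  - intros t t0. rewrite Hq; [| trivial | split; [auto | lra]]. rewrite Hsl by trivial.
    specialize (Hr t t0). unfold A.
    generalize dependent (sqrt (alpha0 * t)). intros r Hr.
    generalize dependent (opE f lam). intros e He. rewrite <- He.
    unfold Ste, alpha0. field. lra.
Qed.

End Data.

Theorem theorem5p3 (d : stefan_data) (lam2 : R)
  (Hpos : positive_data) (HK : hyp_K) (HR : hyp_R) (HV : hyp_V)
  (Hsmall1 : (2 * Bi + rad * (Tstar ^ 4 - Tm ^ 4)) * sqrt (k0 * rho0 * c0 * k_M)
             / (k_m * sqrt gamma_m) * sqrt PI
             * exp (nu_M ^ 2 * k_M / (k_m ^ 2 * gamma_m)) < 1)
  (Hsmall2 : (2 * Bi + rad * D5) * sqrt (rho0 * c0 * k0) / nu_M < 1)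
  (Hlam2_pos : 0 < lam2) (Hlam2 : calV2 lam2 = lam2) (HE : calE lam2 < 1) :
  exists (T : R -> R -> R) (s : R -> R) (lam : R) (f : R -> R),
    stefan_solution T s /\
    0 < lam < lam2 /\
    is_calV lam lam /\
    is_f_lambda lam f /\
    (forall t, 0 < t -> s t = 2 * lam * sqrt (alpha0 * t)) /\
    (forall x t, 0 < t -> 0 <= x / (2 * sqrt (alpha0 * t)) <= lam ->
       T x t = (Tm - Tstar) * f (x / (2 * sqrt (alpha0 * t))) + Tstar).
Proof.
  destruct (fixed_point_root Hpos HK HR HV Hsmall1 lam2 Hlam2_pos HE Hlam2)
    as (lam & f & Hlam & Lf & Ff & Hroot).
  pose proof (unit_lipschitz_continuous _ _ Lf) as Cf. destruct Lf as [Uf _].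
  assert (Hf : is_f_lambda lam f)
    by (apply (Psi_is_f_lambda Hpos HK HR HV lam2); auto; lra).
  exists (fun x t => temp (profile lam f (similarity x t))),
    (fun t => 2 * lam * sqrt (alpha0 * t)), lam, f.
  split; [| split; [| split; [| split; [| split]]]]; trivial.
  - apply (stefan_solution_of_fixed_point Hpos HK HR HV); auto; lra.
  - split; [| now exists f].
    destruct (is_lambda_bar_exists Hpos lam2 Hlam2_pos HE) as (lbar & Hbar & Hlt).
    exists lbar. split; [trivial | lra].
  - intros x t _ Hx. fold (similarity x t) in *.
    fold (temp (f (similarity x t))). f_equal.
    rewrite <- Ff at 1. unfold Psi, profile. now rewrite clamp_id.
Qed.
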